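(* Let $\pi\colon G\to\mathrm{Aut}(V)$ be a group representation of a Lie group $G$ on a Fréchet space $V$ (by continuous linear operators). Then the following are equivalent: (1) $\pi$ is smooth as a representation on a topological vector space; (2) $\pi$ is smooth as a representation on the bornological vector space $V$ with the von Neumann bornology; (3) $\pi$ is smooth as a representation on the bornological vector space $V$ with the precompact bornology.
   Context: A representation is a group homomorphism $\pi\colon G\to\mathrm{Aut}(V)$ (no continuity in $g$ assumed); put $\pi_\ast(v)(g)=\pi_g(v)$. Vector spaces are over $\mathbb{C}$. The von Neumann bornology on $V$ consists of the subsets absorbed by every neighborhood of zero; the precompact bornology consists of the precompact subsets. Both turn the Fréchet space $V$ into a complete convex bornological vector space. Topological smoothness: $\pi_\ast$ is a continuous linear map from $V$ to the usual space of smooth functions $G\to V$ with the topology of locally uniform convergence of all derivatives. Bornological smoothness: for a complete convex bornological vector space $V$, a bounded complete disk is a bounded disk $T\subseteq V$ whose linear span $V_T$, normed so that $T$ is the closed unit ball, is a Banach space. For a Banach space $B$, $\mathcal{D}(G,B)$ is the space of compactly supported smooth functions $G\to B$; a subset $S$ is bounded if its elements are supported in a common compact set and $D(S)$ is uniformly bounded for every differential operator $D$ on $G$. $\mathcal{D}(G,V)=\bigcup_T\mathcal{D}(G,V_T)$ over bounded complete disks $T\subseteq V$, a subset being bounded if it is bounded in some $\mathcal{D}(G,V_T)$. $\mathcal{E}(G,V)$ is the space of functions $f\colon G\to V$ with $h\cdot f\in\mathcal{D}(G,V)$ for all $h\in\mathcal{D}(G,\mathbb{C})$, a subset $S$ being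 bounded if $h\cdot S$ is bounded in $\mathcal{D}(G,V)$ for all such $h$. $\pi$ is smooth if $\pi_\ast$ is a bounded linear map $V\to\mathcal{E}(G,V)$. *)

(* Defs.v *)
From HB Require Import structures.
From mathcomp Require Import all_boot all_order all_algebra complex.
From mathcomp Require Import all_classical all_reals all_analysis.

Set Implicit Arguments.
Unset Strict Implicit.
Unset Printing Implicit Defensive.

Import Order.TTheory GRing.Theory Num.Theory numFieldNormedType.Exports.
Local Open Scope classical_set_scope.
Local Open Scope complex_scope.
Local Open Scope ring_scope.

(** * Smooth functions on open subsets of R^n *)

(* The values lie in a Hausdorff tvs over a field K containing R via j.  Only
   two cases are used: K = R for changes of charts, and K = R[i]. *)
Section EuclideanSmoothness.
Context {R : realType} {K : numFieldType} (j : {rmorphism R -> K}).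
Context {W : tvsType K} {n : nat}.
Implicit Types (f : 'rV[R]_n -> W) (i : 'I_n) (s : seq 'I_n).

Definition diff_quot i f (x : 'rV[R]_n) (h : R) : W :=
  j h^-1 *: (f (x + h *: delta_mx 0 i) - f x).

(* The default value 0 is used where the limit does not exist. *)
Definition partial i f (x : 'rV[R]_n) : W :=
  xget 0 [set l : W | diff_quot i f x @ 0^' --> l].

Definition partials s f : 'rV[R]_n -> W := foldr partial f s.

Definition smooth_on (O : set 'rV[R]_n) f : Prop :=
  forall s (x : 'rV[R]_n), O x ->
    {for x, continuous (partials s f)} /\
    forall i, exists l : W, diff_quot i (partials s f) x @ 0^' --> l.

End EuclideanSmoothness.

(** * Lie groups *)

Record chart (R : realType) (n : nat) (X : topologicalType) := Chart {
  chart_dom : set X;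
  chart_fun : X -> 'rV[R]_n;
  chart_inv : 'rV[R]_n -> X;
  chart_dom_open : open chart_dom;
  chart_img_open : open (chart_fun @` chart_dom);
  chart_funK : forall x, chart_dom x -> chart_inv (chart_fun x) = x;
  chart_fun_continuous : forall x, chart_dom x -> {for x, continuous chart_fun};
  chart_inv_continuous :
    forall y, (chart_fun @` chart_dom) y -> {for y, continuous chart_inv} }.

Definition chart_img (R : realType) n (X : topologicalType) (c : chart R n X) :=
  chart_fun c @` chart_dom c.

(* Smoothness of the inverse and of the product is expressed in charts; in the
   latter case a point of R^(n + n) is a pair of points of R^n.  Continuity
   makes the sets of parameters open.  Countability of the topology is not
   required: a Lie group may have arbitrarily many components. *)
HB.mixin Record isLieGroup (R : realType) (n : nat) G
    & Topological G & monoid.Group G := {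
  lie_hausdorff : hausdorff_space G;
  atlas : set (chart R n G);
  atlas_cover : forall x : G, exists2 c, atlas c & chart_dom c x;
  atlas_smooth : forall c d, atlas c -> atlas d ->
    smooth_on idfun (chart_img c `&` chart_inv c @^-1` chart_dom d)
      (chart_fun d \o chart_inv c);
  mulg_continuous : continuous (fun z : G * G => (z.1 * z.2)%g);
  invg_continuous : continuous (fun x : G => x^-1%g);
  mulg_smooth : forall c d e, atlas c -> atlas d -> atlas e ->
    smooth_on idfun
      [set z : 'rV[R]_(n + n) | [/\ chart_img c (lsubmx z),
          chart_img d (rsubmx z) &
          chart_dom e (chart_inv c (lsubmx z) * chart_inv d (rsubmx z))%g]]
      (fun z => chart_fun e (chart_inv c (lsubmx z) * chart_inv d (rsubmx z))%g);
  invg_smooth : forall c d, atlas c -> atlas d ->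
    smooth_on idfun
      [set y | chart_img c y /\ chart_dom d (chart_inv c y)^-1%g]
      (fun y => chart_fun d (chart_inv c y)^-1%g) }.

#[short(type="lieGroupType")]
HB.structure Definition LieGroup (R : realType) (n : nat) :=
  {G of isLieGroup R n G & Topological G & monoid.Group G}.

(** * Smooth functions and differential operators on a Lie group *)

Section SmoothFunctions.
Context {R : realType} {n : nat} (G : lieGroupType R n) (W : tvsType R[i]).

Definition smooth (f : G -> W) : Prop :=
  forall c : chart R n G, atlas c ->
    smooth_on (real_complex R) (chart_img c) (f \o chart_inv c).

(* Differential operators with smooth scalar coefficients.  They act on smooth
   functions; the value on other functions is irrelevant.  The sum is over all
   words of length at most k in the coordinate directions. *)
Definition diff_operator (P : (G -> W) -> (G -> W)) : Prop :=
  exists k : nat, forall x0 : G,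
  exists (c : chart R n G) (O : set 'rV[R]_n)
         (a : seq 'I_n -> 'rV[R]_n -> R[i]^o),
  [/\ atlas c, chart_dom c x0, open O, O (chart_fun c x0) & O `<=` chart_img c] /\
  (forall s, smooth_on (real_complex R) O (a s)) /\
  forall f, smooth f -> forall y, O y ->
    P f (chart_inv c y) = \sum_(m < k.+1) \sum_(s : m.-tuple 'I_n)
      a s y *: partials (real_complex R) s (f \o chart_inv c) y.

Definition smooth_maps : set (G -> W) := [set f | smooth f].
Definition diff_operators : set ((G -> W) -> (G -> W)) :=
  [set P | diff_operator P].

Definition derivatives (f : smooth_maps) :
    prod_topology (fun _ : diff_operators => {family compact, G -> W}) :=
  fun P => val P (val f).

(* Locally uniform convergence of all derivatives; G is locally compact, so that
   locally uniform convergence is uniform convergence on compact subsets. *)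
Definition Cinfty := initial_topology derivatives.
HB.instance Definition _ := Topological.on Cinfty.
Definition Cinfty_fun (f : Cinfty) : G -> W := val (f : smooth_maps).

End SmoothFunctions.

(** * Fréchet spaces *)

(* The library does not relate the uniform structure of a tvsType to its
   addition; uniform continuity of the subtraction forces it to be the
   translation-invariant one. *)
HB.mixin Record isFrechet (K : numFieldType) V & Tvs K V := {
  frechet_sub_unif_continuous : unif_continuous (fun z : V * V => z.1 - z.2);
  frechet_hausdorff : hausdorff_space V;
  frechet_metrizable : countable_uniformity V;
  frechet_complete : forall F : set_system V,
    ProperFilter F -> cauchy F -> exists l : V, F --> l }.

#[short(type="frechetType")]
HB.structure Definition Frechet (K : numFieldType) :=
  {V of Tvs K V & isFrechet K V}.

(** * The normed space spanned by a disk *)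

Section DiskSpace.
Context {R : realType} {V : lmodType R[i]}.

(* disk_sep makes the gauge a norm; it holds for all bounded disks in a
   Hausdorff space. *)
Record disk := Disk {
  disk_set :> set V;
  disk0 : disk_set 0;
  disk_circled : forall (a : R[i]) x,
    `|a| <= 1 -> disk_set x -> disk_set (a *: x);
  disk_convex : convex_set (M := V) disk_set;
  disk_sep : forall x, (forall a : R[i], disk_set (a *: x)) -> x = 0 }.

Variable T : disk.

(* For a disk, this is the linear span. *)
Definition disk_span : {pred V} :=
  [pred x | `[< exists a : R[i], exists2 y, disk_set T y & x = a *: y >]].

Definition gauge (x : V) : R :=
  inf [set r : R | 0 <= r /\ exists2 y, disk_set T y & x = r%:C *: y].

Lemma disk_comb (a b : R) x y : 0 <= a -> 0 <= b -> disk_set T x -> disk_set T y ->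
  exists2 z, disk_set T z & a%:C *: x + b%:C *: y = (a + b)%:C *: z.
Proof.
move=> a0 b0 Tx Ty; have [ab0|ab0] := eqVneq (a + b) 0.
  have /eqP : a + b == 0 by rewrite ab0.
  move/eqP; rewrite paddr_eq0// => /andP[/eqP-> /eqP->].
  by exists x => //; rewrite addr0 !scale0r addr0.
have abp : 0 < a + b by rewrite lt0r ab0 addr_ge0.
have t0 : 0 <= (a / (a + b))%:C by rewrite lecR divr_ge0// ltW.
have t1 : (a / (a + b))%:C <= 1 by rewrite lecR ler_pdivrMr// mul1r lerDl.
have := @disk_convex T x y (Itv01 t0 t1) (mem_set Tx) (mem_set Ty).
rewrite inE => Tz; eexists; first exact: Tz.
rewrite [conv _ _ _](_ : _ =
  (a / (a + b))%:C *: x + (1 - (a / (a + b))%:C) *: y) //.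
rewrite scalerDr !scalerA mulrBr mulr1 -!rmorphM/= mulrC divfK//.
by rewrite -rmorphB/= addrAC subrr add0r.
Qed.

Lemma disk_scale (a : R[i]) x : disk_set T x ->
  exists2 z, disk_set T z & a *: x = `|a| *: z.
Proof.
move=> Tx; have [->|a0] := eqVneq a 0; first by exists x; rewrite // normr0.
exists ((`|a|^-1 * a) *: x).
  apply: disk_circled => //.
  by rewrite normrM normfV normr_id mulVf// normr_eq0.
by rewrite scalerA mulrA divff ?mul1r// normr_eq0.
Qed.

Lemma gauge_le (r : R) x y : 0 <= r -> disk_set T y -> x = r%:C *: y ->
  gauge x <= r.
Proof.
move=> r0 Ty xE; apply: ge_inf; last by split=> //; exists y.
by exists 0 => s [].
Qed.

Lemma norm_real (a : R[i]) : exists2 r : R, 0 <= r & `|a| = r%:C.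
Proof.
exists (complex.Re `|a|).
  by rewrite -lecR RRe_real ?normr_ge0// ger0_real.
by rewrite RRe_real// ger0_real.
Qed.

Lemma disk_span_real x : x \in disk_span ->
  exists r : R, 0 <= r /\ exists2 y, disk_set T y & x = r%:C *: y.
Proof.
move=> /asboolP[a [y Ty ->]]; have [z Tz ->] := disk_scale a Ty.
by have [r r0 ->] := norm_real a; exists r; split=> //; exists z.
Qed.

Lemma gauge_lt x e : x \in disk_span -> gauge x < e ->
  exists2 r : R, 0 <= r < e & exists2 y, disk_set T y & x = r%:C *: y.
Proof.
move=> /disk_span_real[r [r0 xr]] xe.
have [||s [s0 xs] se] := @inf_lt _ [set r : R | 0 <= r /\
    exists2 y, disk_set T y & x = r%:C *: y] e => //.
  by exists r.
by exists s => //; rewrite s0.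
Qed.

Fact disk_span_submod_closed : submod_closed disk_span.
Proof.
split; first by apply/asboolP; exists 0, 0; [exact: disk0|rewrite scaler0].
move=> a x y /asboolP[b [u Tu ->]] /asboolP[c [v Tv ->]]; apply/asboolP.
rewrite scalerA; have [u' Tu' ->] := disk_scale (a * b) Tu.
have [v' Tv' ->] := disk_scale c Tv.
have [r r0 ->] := norm_real (a * b); have [s s0 ->] := norm_real c.
by have [z Tz ->] := disk_comb r0 s0 Tu' Tv'; exists (r + s)%:C, z.
Qed.
HB.instance Definition _ :=
  GRing.isSubmodClosed.Build R[i] V disk_span disk_span_submod_closed.

Record disk_space := DiskSpace {
  disk_val : V;
  disk_valP : disk_val \in disk_span }.
HB.instance Definition _ := [isSub for disk_val].
HB.instance Definition _ := [Choice of disk_space by <:].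
HB.instance Definition _ := [SubChoice_isSubLmodule of disk_space by <:].

Definition disk_norm (x : disk_space) : R[i] := (gauge (val x))%:C.

Lemma gauge_ge0 x : 0 <= gauge x.
Proof.
have [E0|/set0P ne] := eqVneq [set r : R | 0 <= r /\
    exists2 y, disk_set T y & x = r%:C *: y] set0.
  by rewrite /gauge E0 inf0.
by apply: lb_le_inf => // r [].
Qed.

Lemma disk_normD x y : disk_norm (x + y) <= disk_norm x + disk_norm y.
Proof.
rewrite -rmorphD lecR/=; apply/ler_addgt0Pr => e e0.
have e20 : 0 < e / 2 by rewrite divr_gt0.
have [|r /andP[r0 re] [u Tu xE]] := @gauge_lt (val x) (gauge (val x) + e / 2)
  (valP x); first by rewrite ltrDl.
have [|s /andP[s0 se] [v Tv yE]] := @gauge_lt (val y) (gauge (val y) + e / 2)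
  (valP y); first by rewrite ltrDl.
have [z Tz zE] := disk_comb r0 s0 Tu Tv.
have : gauge (val x + val y) <= r + s.
  by apply: (gauge_le (addr_ge0 r0 s0) Tz); rewrite xE yE.
move/le_trans; apply; rewrite [e]splitr addrACA.
by rewrite lerD ?ltW.
Qed.

Lemma gaugeZ_le (a : R[i]) x : x \in disk_span ->
  (gauge (a *: x))%:C <= `|a| * (gauge x)%:C.
Proof.
move=> xT; have [r r0 aE] := norm_real a; rewrite aE -rmorphM lecR/=.
apply/ler_addgt0Pr => e e0; have r1 : 0 < r + 1 by rewrite ltr_wpDl.
have [|s /andP[s0 se] [u Tu xE]] := @gauge_lt x (gauge x + e / (r + 1)) xT.
  by rewrite ltrDl divr_gt0.
have [z Tz zE] := disk_scale a Tu.
have /le_trans : gauge (a *: x) <= r * s.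
  apply: (gauge_le (mulr_ge0 r0 s0) Tz).
  by rewrite xE scalerA mulrC -scalerA zE aE scalerA -rmorphM/= mulrC.
apply; apply: (@le_trans _ _ (r * (gauge x + e / (r + 1)))).
  by rewrite ler_wpM2l// ltW.
rewrite mulrDr lerD2l mulrCA ger_pMr// ler_pdivrMr// mul1r lerDl//.
Qed.

Lemma disk_normZ (a : R[i]) x : disk_norm (a *: x) = `|a| * disk_norm x.
Proof.
apply/le_anti/andP; split; first exact: gaugeZ_le (valP x).
have [->|a0] := eqVneq a 0; first by rewrite normr0 mul0r lecR gauge_ge0.
have := gaugeZ_le a^-1 (valP (a *: x)).
rewrite [val (a *: x)]/(a *: val x) scalerK// normfV.
by rewrite ler_pdivlMl ?normr_gt0.
Qed.

Lemma disk_norm0_eq0 x : disk_norm x = 0 -> x = 0.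
Proof.
move=> [/eqP]; rewrite eq_le => /andP[x0 _].
apply: val_inj; apply: (disk_sep (d := T)) => a.
have [r r0 aE] := norm_real a; have r1 : 0 < r + 1 by rewrite ltr_wpDl.
have [|s /andP[s0 se] [u Tu ->]] := @gauge_lt (val x) (r + 1)^-1 (valP x).
  by rewrite (le_lt_trans x0) ?invr_gt0.
rewrite scalerA; apply: disk_circled => //.
rewrite normrM aE ger0_norm ?lecR// -rmorphM lecR/=.
have : (r + 1) * s <= 1 by rewrite -ler_pdivlMl// mulr1 ltW.
by apply: le_trans; rewrite ler_wpM2r// lerDl.
Qed.

HB.instance Definition _ := Lmodule_isNormed.Build R[i] disk_space
  disk_normD disk_normZ disk_norm0_eq0.

End DiskSpace.

Arguments disk {R} V.

(** * Bornological function spaces *)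

(* A bornology is given by its family of bounded subsets. *)
Section Bornologies.
Context {R : realType} {V : tvsType R[i]}.

Definition absorbs (U S : set V) : Prop :=
  exists2 r : R, 0 < r & forall a : R[i], r%:C <= `|a| ->
    S `<=` [set a *: u | u in U].

Definition von_neumann : set_system V :=
  [set S | forall U, nbhs (0 : V) U -> absorbs U S].

(* Precompact means totally bounded, here for the additive uniformity. *)
Definition precompact_bornology : set_system V :=
  [set S | forall U, nbhs (0 : V) U ->
    exists2 A : set V, finite_set A & S `<=` [set a + u | a in A & u in U]].

End Bornologies.

Section BanachTestFunctions.
Context {R : realType} {n : nat} (G : lieGroupType R n) (B : normedModType R[i]).

(* The space D(G, B) and its bounded subsets. *)
Definition test_functions : set (G -> B) :=
  [set f | smooth f /\
    exists2 K : set G, compact K & forall x, ~ K x -> f x = 0].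

Definition bounded_test_functions : set_system (G -> B) :=
  [set S | [/\ S `<=` test_functions,
    exists2 K : set G, compact K & forall f x, S f -> ~ K x -> f x = 0 &
    forall P, diff_operator P ->
      exists M : R, forall f x, S f -> `|P f x| <= M%:C]].

End BanachTestFunctions.

Arguments test_functions {R n} G B.

Section BornologicalFunctionSpaces.
Context {R : realType} {n : nat} (G : lieGroupType R n) {V : lmodType R[i]}.
Variable bounded : set_system V.

Definition bounded_complete_disk (T : disk V) : Prop :=
  [/\ bounded T,
      forall x : disk_space T, `|x| <= 1 -> disk_set T (val x) &
      forall F : set_system (disk_space T), ProperFilter F -> cauchy F -> cvg F].

Definition disk_incl (T : disk V) (f : G -> disk_space T) : G -> V :=
  fun x => val (f x).

(* The space D(G, V) and its bounded subsets. *)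
Definition born_test_functions : set (G -> V) :=
  [set f | exists2 T : disk V, bounded_complete_disk T &
    (@disk_incl T @` test_functions G (disk_space T)) f].

Definition bounded_born_test_functions : set_system (G -> V) :=
  [set S | exists2 T : disk V, bounded_complete_disk T &
    exists2 S', bounded_test_functions S' & S = @disk_incl T @` S'].

Definition cutoff (h : G -> R[i]^o) (f : G -> V) : G -> V :=
  fun x => (h x : R[i]) *: f x.

(* The space E(G, V) and its bounded subsets. *)
Definition born_smooth_functions : set (G -> V) :=
  [set f | forall h, test_functions G R[i]^o h ->
    born_test_functions (cutoff h f)].

Definition bounded_born_smooth_functions : set_system (G -> V) :=
  [set S | S `<=` born_smooth_functions /\
    forall h, test_functions G R[i]^o h ->
      bounded_born_test_functions (cutoff h @` S)].

End BornologicalFunctionSpaces.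

Arguments born_smooth_functions {R n} G {V} bounded.

(** * Representations *)

Record representation (R : realType) (G : groupType) (V : tvsType R[i]) :=
  Representation {
    rep_fun :> G -> {linear V -> V};
    rep_continuous : forall g, continuous (rep_fun g);
    rep1 : forall v, rep_fun 1%g v = v;
    repM : forall g h v, rep_fun (g * h)%g v = rep_fun g (rep_fun h v) }.

Section SmoothRepresentations.
Context {R : realType} {n : nat} {G : lieGroupType R n} {V : tvsType R[i]}.
Variable pi : representation G V.

Definition orbit_map (v : V) : G -> V := fun g => pi g v.

Fact orbit_map_is_linear : linear orbit_map.
Proof. by move=> a u v; apply/funext => g; exact: linearP. Qed.
HB.instance Definition _ :=
  GRing.isLinear.Build R[i] V (G -> V) _ orbit_map orbit_map_is_linear.

Definition topologically_smooth : Prop :=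
  exists2 F : V -> Cinfty G V, continuous F & forall v, Cinfty_fun (F v) = orbit_map v.

Definition bornologically_smooth (bounded : set_system V) : Prop :=
  (forall v, born_smooth_functions G bounded (orbit_map v)) /\
  forall S, bounded S ->
    bounded_born_smooth_functions bounded (orbit_map @` S).

End SmoothRepresentations.

(* Main.v *)
(* Both bornologies contain the null sequences and are stable under images
   {F_x(v) : v in S, x in L} for equicontinuous families F_x indexed
   continuously by a compact set L, and under closed disk hulls; only such
   closure properties are used.

   If [pi] is smooth on the topological vector space V and S is bounded, then
   for each order m the derivatives of order at most m of the orbit maps of
   v in S, over a compact subset of G, stay in one bounded set.  As V is
   metrizable, a single closed bounded disk T absorbs these sets for all m at
   once, and V_T is a Banach space.  Estimating difference quotients by the mean
   value theorem in V, with remainders in multiples of T, shows that the orbit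
   maps times a test function are smooth into V_T, with bounds uniform in S.

   Conversely, orbit maps are locally smooth into some V_T, hence into V.  If
   v |-> P(pi_* v) were not continuous at 0 uniformly near some point, there
   would be a null sequence s_k such that the values of P on the orbit maps of
   s_k/(k+1) avoid a neighbourhood of 0 near this point; but {s_k} is bounded,
   so P maps the localized orbit maps of all s_k into a multiple of some T. *)

Require Import Defs.
From mathcomp Require Import all_boot all_order all_algebra complex.
From mathcomp Require Import all_classical all_reals all_analysis.
From mathcomp Require Import ring lra.

Set Implicit Arguments.
Unset Strict Implicit.
Unset Printing Implicit Defensive.

Import Order.TTheory GRing.Theory Num.Theory numFieldNormedType.Exports.
Local Open Scope classical_set_scope.
Local Open Scope complex_scope.
Local Open Scope ring_scope.

(** * Absolutely convex neighbourhoods and the mean value theorem *)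

Section ComplexScalars.
Context {R : realType}.

(** The gauge topology on the span of [T] is finer than that of [V], so convergence of difference
    quotients in [V] does not give convergence in the span. Bounds on derivatives replace it: a
    bound on one more order gives a Lipschitz estimate for the gauge, hence continuity; the same
    estimate for a first derivative gives a quadratic remainder, hence differentiability. Each order
    uses the next ones, so one disk has to absorb all orders. The estimates come from the mean value
    theorem in [V] for the convex sets [M T + U], with [U] a neighbourhood of 0; closedness of [T]
    in [V] then removes [U]. A second obstacle is that topological smoothness speaks of global
    differential operators, while partial derivatives live in charts. Bump functions turn chart
    derivatives into global operators, and the chain rule carries the resulting bounds to all other
    charts. In the converse direction the factor [1/(k+1)] is what turns boundedness of the values
    into smallness. *)

Lemma normc_real (r : R) : `|r%:C| = `|r|%:C.
Proof. by rewrite normc_def /= expr0n/= addr0 sqrtr_sqr. Qed.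

Lemma gtc0_real (e : R[i]) : 0 < e -> exists2 r : R, 0 < r & e = r%:C.
Proof.
move=> e0; have eR : e \is Num.real by rewrite gtr0_real.
by exists (complex.Re e); rewrite ?RRe_real// -ltcR RRe_real.
Qed.

Lemma real_complex_continuous : continuous (real_complex R : R -> R[i]^o).
Proof.
move=> x; apply/cvgrPdist_lt => e /gtc0_real[r r0 ->].
near=> y; rewrite -rmorphB normc_real ltcR.
by near: y; apply: cvgr_dist_lt.
Unshelve. all: by end_near. Qed.

End ComplexScalars.

Section TvsLimits.
Context {K : numFieldType} {W : tvsType K}.

Lemma tvs_cvgD {T : Type} (F : set_system T) {FF : Filter F} (f g : T -> W) a b :
  f @ F --> a -> g @ F --> b -> (fun x => f x + g x) @ F --> a + b.
Proof. by move=> fa gb; apply: continuous2_cvg fa gb => //; exact: (@add_continuous _ (a, b)). Qed.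

Lemma tvs_cvgZ {T : Type} (F : set_system T) {FF : Filter F} (s : T -> K^o)
    (f : T -> W) k a :
  s @ F --> (k : K^o) -> f @ F --> a -> (fun x => (s x : K) *: f x) @ F --> (k : K) *: a.
Proof.
move=> sk fa; apply: (@continuous2_cvg T K^o W W F FF s f (fun s x => (s : K) *: x)) sk fa.
exact: (@scale_continuous _ _ ((k : K^o), a)).
Qed.

Lemma tvs_cvgN {T : Type} (F : set_system T) {FF : Filter F} (f : T -> W) a :
  f @ F --> a -> (fun x => - f x) @ F --> - a.
Proof. by move=> fa; apply: (cvg_comp _ _ fa); exact: opp_continuous. Qed.

Lemma tvs_cvgB {T : Type} (F : set_system T) {FF : Filter F} (f g : T -> W) a b :
  f @ F --> a -> g @ F --> b -> (fun x => f x - g x) @ F --> a - b.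
Proof. by move=> fa gb; apply: tvs_cvgD => //; exact: tvs_cvgN. Qed.

Lemma tvs_cvgZl {T : Type} (F : set_system T) {FF : Filter F} k (f : T -> W) a :
  f @ F --> a -> (fun x => k *: f x) @ F --> k *: a.
Proof. by move=> fa; apply: (tvs_cvgZ (s := fun=> k : K^o)) => //; exact: cvg_cst. Qed.

Lemma tvs_cvgZr {T : Type} (F : set_system T) {FF : Filter F} (s : T -> K^o) k (a : W) :
  s @ F --> (k : K^o) -> (fun x => (s x : K) *: a) @ F --> (k : K) *: a.
Proof. by move=> sk; apply: tvs_cvgZ => //; exact: cvg_cst. Qed.

Lemma tvs_cvg_sum {T : Type} (F : set_system T) {FF : Filter F} (I : eqType)
    (r : seq I) (f : I -> T -> W) (a : I -> W) :
  (forall i, i \in r -> f i @ F --> a i) ->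
  (fun x => \sum_(i <- r) f i x) @ F --> \sum_(i <- r) a i.
Proof.
elim: r => [|i r IH] h.
  by rewrite big_nil; under eq_fun do rewrite big_nil; exact: cvg_cst.
rewrite big_cons; under eq_fun do rewrite big_cons.
apply: tvs_cvgD; first by apply: h; rewrite mem_head.
by apply: IH => j jr; apply: h; rewrite inE jr orbT.
Qed.

Lemma nbhs_shift (x : W) (A : set W) : nbhs x A <-> nbhs 0 [set d | A (x + d)].
Proof.
split=> h.
  have : (fun d => x + d) @ (0 : W) --> x + 0.
    by apply: tvs_cvgD; [exact: cvg_cst|exact: cvg_id].
  by rewrite addr0; apply.
have : (fun y => y - x) @ x --> x - x.
  by apply: tvs_cvgB; [exact: cvg_id|exact: cvg_cst].
rewrite subrr => /(_ _ h); rewrite nbhs_filterE/=; apply: filterS => y /=.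
by rewrite addrC subrK.
Qed.

End TvsLimits.

Section AbsolutelyConvex.
Context {R : realType} {V : lmodType R[i]}.
Implicit Types D E : set V.

Definition absconvex D :=
  [/\ D 0, forall (a : R[i]) x, `|a| <= 1 -> D x -> D (a *: x) & convex_set (M := V) D].

Definition dilate (r : R) D : set V := [set r%:C *: z | z in D].

(** The weights of [convex_set] are elements of [R[i]] between 0 and 1; being comparable with 0 they
    are real, so real weights suffice. *)
Lemma convex_setI D :
  (forall a b x y, 0 <= a -> 0 <= b -> a + b = 1 -> D x -> D y ->
    D (a%:C *: x + b%:C *: y)) -> convex_set (M := V) D.
Proof.
move=> h x y l; rewrite !inE => Dx Dy.
have l0 : 0 <= l%:num by [].
have l1 : l%:num <= 1 :> R[i] by [].
have lR : (complex.Re l%:num)%:C = l%:num by rewrite RRe_real// ger0_real.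
move: l0 l1; rewrite -lR lecR => l0; rewrite lecR => l1.
have := h _ (1 - complex.Re l%:num) x y l0; rewrite subr_ge0 addrC subrK.
by move=> /(_ l1 erefl Dx Dy); rewrite rmorphB/= lR.
Qed.

(** Keeping the factor [a + b], instead of normalising the weights, includes the case of two zero
    weights. *)
Lemma convex_comb D (a b : R) x y : convex_set (M := V) D ->
  0 <= a -> 0 <= b -> D x -> D y ->
  exists2 z, D z & a%:C *: x + b%:C *: y = (a + b)%:C *: z.
Proof.
move=> cD a0 b0 Dx Dy; have [ab0|ab0] := eqVneq (a + b) 0.
  have /eqP : a + b == 0 by rewrite ab0.
  move/eqP; rewrite paddr_eq0// => /andP[/eqP-> /eqP->].
  by exists x => //; rewrite addr0 !scale0r addr0.
have abp : 0 < a + b by rewrite lt0r ab0 addr_ge0.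
have t0 : 0 <= (a / (a + b))%:C by rewrite lecR divr_ge0// ltW.
have t1 : (a / (a + b))%:C <= 1 by rewrite lecR ler_pdivrMr// mul1r lerDl.
have := cD x y (Itv01 t0 t1) (mem_set Dx) (mem_set Dy).
rewrite inE => Dz; eexists; first exact: Dz.
rewrite [conv _ _ _](_ : _ =
  (a / (a + b))%:C *: x + (1 - (a / (a + b))%:C) *: y) //.
rewrite scalerDr !scalerA mulrBr mulr1 -!rmorphM/= mulrC divfK//.
by rewrite -rmorphB/= addrAC subrr add0r.
Qed.

Lemma convex_comb1 D (a b : R) x y : convex_set (M := V) D ->
  0 <= a -> 0 <= b -> a + b = 1 -> D x -> D y -> D (a%:C *: x + b%:C *: y).
Proof.
move=> cD a0 b0 ab1 Dx Dy; have [z Dz ->] := convex_comb cD a0 b0 Dx Dy.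
by rewrite ab1 scale1r.
Qed.

Lemma convex_add D E : convex_set (M := V) D -> convex_set (M := V) E ->
  convex_set (M := V) [set x + y | x in D & y in E].
Proof.
move=> cD cE; apply: convex_setI => a b _ _ a0 b0 ab1 [x Dx [y Ey <-]] [u Du [v Ev <-]].
exists (a%:C *: x + b%:C *: u); first exact: convex_comb1.
exists (a%:C *: y + b%:C *: v); first exact: convex_comb1.
by rewrite !scalerDr addrACA.
Qed.

Lemma convex_translate a D : convex_set (M := V) D ->
  convex_set (M := V) [set x | D (x - a)].
Proof.
move=> cD; apply: convex_setI => s t x y s0 t0 st1 Dx Dy /=.
rewrite [X in D X](_ : _ = s%:C *: (x - a) + t%:C *: (y - a)); first exact: convex_comb1.
by rewrite !scalerBr addrACA -opprD -scalerDl -rmorphD/= st1 scale1r.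
Qed.

Lemma convex_dilate r D : convex_set (M := V) D -> convex_set (M := V) (dilate r D).
Proof.
move=> cD; apply: convex_setI => s t _ _ s0 t0 st1 [x Dx <-] [y Dy <-].
exists (s%:C *: x + t%:C *: y); first exact: convex_comb1.
by rewrite scalerDr !scalerA ![r%:C * _]mulrC.
Qed.

Lemma absconvex_add D E : absconvex D -> absconvex E ->
  absconvex [set x + y | x in D & y in E].
Proof.
move=> [D0 cD vD] [E0 cE vE]; split.
- by exists 0 => //; exists 0 => //; rewrite addr0.
- move=> a _ a1 [x Dx [y Ey <-]]; exists (a *: x); first exact: cD.
  by exists (a *: y); [exact: cE|rewrite scalerDr].
- exact: convex_add.
Qed.

Lemma absconvex_dilate r D : absconvex D -> absconvex (dilate r D).
Proof.
move=> [D0 cD vD]; split.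
- by exists 0 => //; rewrite scaler0.
- move=> a _ a1 [x Dx <-]; exists (a *: x); first exact: cD.
  by rewrite !scalerA mulrC.
- exact: convex_dilate.
Qed.

Lemma absconvexN D x : absconvex D -> D x -> D (- x).
Proof. by case=> _ cD _ Dx; rewrite -scaleN1r; apply: cD => //; rewrite normrN normr1. Qed.

Lemma dilate_le D r s : absconvex D -> 0 <= r -> r <= s -> dilate r D `<=` dilate s D.
Proof.
move=> [D0 cD vD] r0 rs _ [x Dx <-].
have [s0|s0] := eqVneq s 0.
  by exists x; rewrite // s0 (_ : r = 0)//; apply/eqP; rewrite eq_le r0 -s0 rs.
have sp : 0 < s by rewrite lt0r s0 (le_trans r0).
exists ((r / s)%:C *: x).
  apply: cD => //; rewrite normc_real lecR ger0_norm ?divr_ge0 ?(ltW sp)//.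
  by rewrite ler_pdivrMr// mul1r.
by rewrite scalerA -rmorphM/= mulrC divfK.
Qed.

Lemma dilate_circled D (a : R[i]) (r s : R) x : absconvex D -> `|a| <= r%:C -> dilate s D x ->
  0 <= s -> dilate (r * s) D (a *: x).
Proof.
move=> [D0 cD vD] ar [y Dy <-] s0.
have [r0|r0] := eqVneq r 0.
  move: ar; rewrite r0 normr_le0 => /eqP ->; rewrite mul0r scale0r.
  by exists 0 => //; rewrite scaler0.
have rp : 0 < r by rewrite lt0r r0 -lecR; exact: le_trans (normr_ge0 a) ar.
exists ((a / r%:C) *: y).
  apply: cD => //; rewrite normrM normfV normc_real (gtr0_norm rp).
  by rewrite ler_pdivrMr ?ltcR// mul1r.
rewrite !scalerA; congr (_ *: _); rewrite rmorphM/= mulrC mulrA divfK//.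
by rewrite fmorph_eq0.
Qed.

Lemma dilateD D (r s : R) x y : convex_set (M := V) D -> 0 <= r -> 0 <= s ->
  dilate r D x -> dilate s D y -> dilate (r + s) D (x + y).
Proof.
move=> cD r0 s0 [u Du <-] [v Dv <-].
by have [z Dz ->] := convex_comb cD r0 s0 Du Dv; exists z.
Qed.

Lemma dilateM D (r s : R) x : dilate s D x -> dilate (r * s) D (r%:C *: x).
Proof. by move=> [z Dz <-]; exists z; rewrite // scalerA rmorphM. Qed.

Lemma dilate1 D : dilate 1 D = D.
Proof.
apply/seteqP; split=> [_ [z Dz <-]|z Dz]; first by rewrite scale1r.
by exists z; rewrite // scale1r.
Qed.

End AbsolutelyConvex.

Section DiskNeighbourhoods.
Context {R : realType} {V : tvsType R[i]}.
Implicit Types D U : set V.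

Lemma nbhs0_scale (k : R[i]) U : nbhs (0 : V) U -> nbhs (0 : V) [set x | U (k *: x)].
Proof.
move=> U0; have : (fun x => k *: x) @ (0 : V) --> k *: 0 by apply: tvs_cvgZl; exact: cvg_id.
by rewrite scaler0; apply.
Qed.

(** The circled core of a convex neighbourhood [C] stays convex. Joint continuity of scaling at
    [(0, 0)] makes it a neighbourhood: scalars below some [e] times a neighbourhood [A2] fall into
    [C], so the core contains [(e / 2) A2]. *)
Lemma nbhs_absconvex U : nbhs (0 : V) U ->
  exists D, [/\ nbhs 0 D, absconvex D & D `<=` U].
Proof.
move=> U0; have [B Bc [Bo Bb]] := @locally_convex _ V.
have [C [BC C0] CU] := Bb _ _ U0.
have cC : convex_set (M := V) C by apply: Bc; rewrite inE.
have C0' : nbhs 0 C by apply: open_nbhs_nbhs; split=> //; exact: Bo.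
exists [set x | forall a : R[i], `|a| <= 1 -> C (a *: x)]; split.
- have := @scale_continuous _ V ((0 : R[i]^o), (0 : V)) C.
  rewrite /= scaler0 => /(_ C0')[[/= A1 A2] [A1n A2n] AC].
  have [_/posnumP[e] eA] : exists2 e : R[i], 0 < e & ball (0 : R[i]^o) e `<=` A1.
    by move: A1n => /nbhs_ballP[e e0 eA]; exists e.
  have e2 : e%:num / 2 != 0 by rewrite mulf_neq0// invr_neq0.
  apply: filterS (nbhs0Z e2 A2n) => _ [y A2y <-] a a1; rewrite scalerA.
  apply: (AC (_, y)); split => //=; apply: eA; rewrite -ball_normE/= sub0r normrN.
  rewrite normrM (@le_lt_trans _ _ `|e%:num / 2|)//; first by rewrite ler_piMl.
  by rewrite gtr0_norm// ltr_pdivrMr// ltr_pMr// ltr1n.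
- split.
  + by move=> a a1; rewrite scaler0; exact: nbhs_singleton.
  + move=> a x a1 Dx b b1; rewrite scalerA; apply: Dx.
    by rewrite normrM mulr_ile1.
  + apply: convex_setI => a b x y a0 b0 ab1 Dx Dy c c1.
    rewrite scalerDr !scalerA ![c * _]mulrC -!scalerA.
    by apply: convex_comb1 => //; [exact: Dx|exact: Dy].
- by move=> x /(_ 1); rewrite normr1 scale1r => /(_ (lexx _)) /CU.
Qed.

Lemma nbhs_absconvex_half U : nbhs (0 : V) U -> exists D, [/\ nbhs 0 D, absconvex D,
  D `<=` U & forall x y, D x -> D y -> U (x + y)].
Proof.
move=> /nbhs_absconvex[D [D0 aD DU]]; exists (dilate 2^-1 D); split.
- have n2 : ((2^-1 : R)%:C) != 0 by rewrite fmorph_eq0 invr_eq0.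
  exact: nbhs0Z n2 D0.
- exact: absconvex_dilate.
- move=> x Dx; apply: DU; rewrite -[D]dilate1; apply: dilate_le Dx => //.
  by rewrite invf_le1// ler1n.
- move=> x y Dx Dy; apply: DU; rewrite -[D]dilate1 (splitr 1) !div1r.
  by case: aD => _ _ cD; apply: dilateD.
Qed.

Lemma nbhs_dilate (r : R) D : r != 0 -> nbhs (0 : V) D -> nbhs (0 : V) (dilate r D).
Proof. by move=> r0; apply: nbhs0Z; rewrite fmorph_eq0. Qed.

Lemma cvg_diskP {T : Type} (F : set_system T) {FF : Filter F} (f : T -> V) l :
  f @ F --> l <-> forall D, nbhs (0 : V) D -> absconvex D -> \forall x \near F, D (f x - l).
Proof.
split=> [fl D D0 _|h A].
  have : (fun x => f x - l) @ F --> l - l by apply: tvs_cvgB => //; exact: cvg_cst.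
  by rewrite subrr; apply.
move=> /nbhs_shift /nbhs_absconvex[D [D0 aD DA]].
apply: filterS (h _ D0 aD) => x /DA /=; by rewrite addrC subrK.
Qed.

Lemma nbhs_absconvex_translate (l : V) D : nbhs (0 : V) D -> nbhs l [set x | D (x - l)].
Proof.
move=> D0; apply/nbhs_shift; apply: filterS D0 => x /=.
by rewrite addrC addKr.
Qed.

(* The supremum of the times up to which the estimate holds is reached, since
   near a time [t] the increments on both sides of [t] lie in multiples of [D],
   which convexity lets one add up. *)
Lemma mean_value (g : R -> V) (a b : R) D : a <= b -> convex_set (M := V) D ->
  (forall t, a <= t <= b -> exists2 l : V, nbhs l D &
     (fun h : R => (h^-1)%:C *: (g (t + h) - g t)) @ 0^' --> l) ->
  exists2 z, D z & g b - g a = (b - a)%:C *: z.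
Proof.
move=> ab cD hd.
(* The derivative at [t] is interior to [D], so difference quotients for small [h] of either sign
   lie in [D]. *)
have loc t : a <= t <= b -> exists2 d : R, 0 < d & forall h, `|h| < d ->
    exists2 z, D z & g (t + h) - g t = h%:C *: z.
  move=> /hd[l lD /(_ _ lD)]; rewrite nbhs_filterE/=.
  move=> /nbhs_ballP[d d0 hD]; exists d => // h hd'.
  have [->|h0] := eqVneq h 0.
    by exists l; [exact: nbhs_singleton|rewrite addr0 subrr scale0r].
  exists ((h^-1)%:C *: (g (t + h) - g t)).
    by apply: hD => //; rewrite /ball/= sub0r normrN.
  by rewrite scalerA -rmorphM/= divff// scale1r.
pose S := [set t | a <= t <= b /\ exists2 z, D z & g t - g a = (t - a)%:C *: z].
have Sa : S a.
  split; first by rewrite lexx ab.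
  have [l lD _] := hd a (introT andP (conj (lexx _) ab)).
  by exists l; [exact: nbhs_singleton|rewrite !subrr scale0r].
have Sub : has_ubound S by exists b => t [/andP[]].
have hS : has_sup S by split=> //; exists a.
set s := sup S.
have as_ : a <= s by apply: ub_le_sup.
have sb : s <= b by apply: ge_sup; [exists a|move=> t [/andP[]]].
have [d d0 hd'] := loc s (introT andP (conj as_ sb)).
have [t St st] := @sup_adherent _ S d d0 hS.
have ts : t <= s by apply: ub_le_sup.
have key s' : s <= s' -> s' <= b -> s' < s + d -> S s'.
  move=> ss' s'b s'd; split; first by rewrite s'b (le_trans as_).
  case: St => /andP[at_ tb] [z Dz gt].
  have [|z1 Dz1 g1] := hd' (t - s).
    by rewrite distrC ger0_norm ?subr_ge0// ltrBlDr -ltrBlDl.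
  have [|z2 Dz2 g2] := hd' (s' - s).
    by rewrite ger0_norm ?subr_ge0// ltrBlDl.
  have e x : s + (x - s) = x by rewrite addrC subrK.
  rewrite !e in g1 g2.
  have tel (x y w : V) : w - y + (y - x) = w - x by rewrite addrA subrK.
  have -> : g s' - g a = (t - a)%:C *: z + ((s - t)%:C *: z1 + (s' - s)%:C *: z2).
    rewrite -gt -g2 -[s - t]opprB rmorphN scaleNr -g1 opprB.
    by rewrite (addrC (g s - g t)) tel (addrC (g t - g a)) tel.
  have p1 : 0 <= s - t by rewrite subr_ge0.
  have p2 : 0 <= s' - s by rewrite subr_ge0.
  have p3 : 0 <= t - a by rewrite subr_ge0.
  have [w Dw ->] := convex_comb cD p1 p2 Dz1 Dz2.
  have [v Dv ->] := convex_comb cD p3 (addr_ge0 p1 p2) Dz Dw.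
  by exists v => //; congr (_%:C *: _); ring.
have Ss : S s by apply: key => //; rewrite ltrDl.
have [sb'|bs] := ltP s b.
  set u := Num.min b (s + d / 2).
  have su : s < u by rewrite lt_min sb' ltrDl divr_gt0.
  have ud : u < s + d.
    have : u <= s + d / 2 by rewrite ge_min lexx orbT.
    move/le_lt_trans; apply; rewrite ltrD2l.
    by rewrite ltr_pdivrMr// ltr_pMr// ltr1n.
  have /(ub_le_sup Sub) : S u by apply: key (ltW su) _ ud; rewrite ge_min lexx.
  by rewrite -/s leNgt su.
have <- : s = b by apply/eqP; rewrite eq_le sb.
by case: Ss.
Qed.

End DiskNeighbourhoods.

(** * Partial derivatives *)

Lemma near_cvg (T : Type) (U : topologicalType) (F : set_system T) {FF : Filter F}
    (f g : T -> U) (l : U) :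
  (\forall x \near F, f x = g x) -> f @ F --> l -> g @ F --> l.
Proof. by move=> fg; apply: cvg_trans; apply: near_eq_cvg; apply: filterS fg => x ->. Qed.

Lemma tvs_continuousD (K : numFieldType) (W : tvsType K) (T : topologicalType) (f g : T -> W) x :
  {for x, continuous f} -> {for x, continuous g} -> {for x, continuous (fun y => f y + g y)}.
Proof. exact: tvs_cvgD. Qed.

Lemma tvs_continuousZ (K : numFieldType) (W : tvsType K) (T : topologicalType)
    (a : T -> K^o) (f : T -> W) x :
  {for x, continuous a} -> {for x, continuous f} -> {for x, continuous (fun y => (a y : K) *: f y)}.
Proof. exact: tvs_cvgZ. Qed.

Section Line.
Context {R : realType} {n : nat}.

Lemma line_cvg (x : 'rV[R]_n) (i : 'I_n) : (fun h : R => x + h *: delta_mx 0 i) @ 0^' --> x.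
Proof.
rewrite -[X in _ --> X]addr0 -(scale0r (delta_mx 0 i : 'rV[R]_n)).
apply: tvs_cvgD; first exact: cvg_cst.
by apply: (tvs_cvgZr (s := fun h : R => h : R^o)); exact: nbhs_dnbhs.
Qed.

Lemma near_line (x : 'rV[R]_n) (i : 'I_n) (A : set 'rV[R]_n) :
  nbhs x A -> \forall h \near (0 : R)^', A (x + h *: delta_mx 0 i).
Proof. by move=> xA; have := @line_cvg x i _ xA. Qed.

End Line.

Section PartialDerivatives.
Context {R : realType} {K : numFieldType} (j : {rmorphism R -> K}).
Context {W : tvsType K} {n : nat}.
Implicit Types (f g : 'rV[R]_n -> W) (i : 'I_n) (O : set 'rV[R]_n) (x : 'rV[R]_n).

Definition is_partial i f x (l : W) := diff_quot j i f x @ 0^' --> l.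

Lemma partialE i f x l : hausdorff_space W -> is_partial i f x l -> partial j i f x = l.
Proof.
move=> hW fl; rewrite /partial; case: xgetP => [l' _ fl'|/(_ l)//].
exact: cvg_unique fl' fl.
Qed.

Lemma diff_quot_near i f g x : (\forall y \near x, f y = g y) ->
  \forall h \near (0 : R)^', diff_quot j i f x h = diff_quot j i g x h.
Proof.
move=> fg; have fgx := nbhs_singleton fg.
apply: filterS (near_line i fg) => h fgh.
by rewrite /diff_quot fgh fgx.
Qed.

Lemma is_partial_near i f g x l : (\forall y \near x, f y = g y) ->
  is_partial i f x l -> is_partial i g x l.
Proof.
by move=> /(diff_quot_near i); exact: near_cvg.
Qed.

Lemma partial_near i f g x : (\forall y \near x, f y = g y) ->
  partial j i f x = partial j i g x.
Proof.
move=> fg; rewrite /partial; congr xget; apply/seteqP; split=> l /=.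
  exact: is_partial_near.
by apply: is_partial_near; apply: filterS fg => y ->.
Qed.

Lemma partials_near s f g x : (\forall y \near x, f y = g y) ->
  \forall y \near x, partials j s f y = partials j s g y.
Proof.
move=> fg; elim: s => [//|i s IH] /=; move/near_join: IH; apply: filterS => y.
exact: partial_near.
Qed.

Lemma continuous_near f g x : (\forall y \near x, f y = g y) ->
  {for x, continuous f} -> {for x, continuous g}.
Proof.
move=> fg cf; rewrite /prop_for /continuous_at -(nbhs_singleton fg).
exact: (@near_cvg _ _ (nbhs x) _ f).
Qed.

Lemma smooth_on_near O f g : (forall x, O x -> \forall y \near x, f y = g y) ->
  smooth_on j O f -> smooth_on j O g.
Proof.
move=> fg sf s x Ox; have [cf df] := sf s x Ox.
have fgs := partials_near s (fg x Ox); split; first exact: continuous_near cf.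
by move=> i; have [l fl] := df i; exists l; apply: is_partial_near fl.
Qed.

Lemma smooth_on_subset O O' f : O' `<=` O -> smooth_on j O f -> smooth_on j O' f.
Proof. by move=> sO sf s x /sO; exact: sf. Qed.

Lemma smooth_on_continuous O f x : smooth_on j O f -> O x -> {for x, continuous f}.
Proof. by move=> sf Ox; have [] := sf [::] x Ox. Qed.

Lemma smooth_on_partials O f s : smooth_on j O f -> smooth_on j O (partials j s f).
Proof.
move=> sf t x Ox; have := sf (t ++ s) x Ox.
by rewrite (_ : partials j (t ++ s) f = partials j t (partials j s f))// /partials foldr_cat.
Qed.

Lemma smooth_on_is_partial O f i x : hausdorff_space W -> smooth_on j O f -> O x ->
  is_partial i f x (partial j i f x).
Proof.
move=> hW sf Ox; have [_ /(_ i)[l fl]] := sf [::] x Ox.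
by rewrite (partialE hW fl).
Qed.

(** Smoothness speaks of all words at once. Bounding the order permits induction for products and
    composites, whose derivatives are sums of products and composites of lower order. *)
Fixpoint Ck (k : nat) O f : Prop :=
  (forall x, O x -> {for x, continuous f}) /\
  if k is k'.+1 then forall i, (forall x, O x -> exists l, is_partial i f x l) /\
    Ck k' O (partial j i f) else True.

Lemma Ck_continuous k O f x : Ck k O f -> O x -> {for x, continuous f}.
Proof. by case: k => [|k] [cf _]; exact: cf. Qed.

Lemma smooth_on_Ck O f : smooth_on j O f <-> forall k, Ck k O f.
Proof.
split=> [sf k|Cf].
  elim: k f sf => [|k IH] f sf; (split; first by move=> x; exact: smooth_on_continuous sf) => //.
  move=> i; split; first by move=> x Ox; have [_] := sf [::] x Ox; exact.
  exact: IH (smooth_on_partials [:: i] sf).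
have CP s k : Ck k O (partials j s f).
  elim: s k => [|i s IH] k /=; first exact: Cf.
  by have /= [_ /(_ i)[]] := IH k.+1.
move=> s x Ox; have /= [cf df] := CP s 1; split; first exact: cf.
by move=> i; have [+ _] := df i; apply.
Qed.

Lemma CkS k O f : Ck k.+1 O f -> Ck k O f.
Proof.
elim: k f => [|k IH] f [cf df]; split => // i.
by have [? /IH] := df i.
Qed.

Lemma Ck_eq k O f g : open O -> (forall x, O x -> f x = g x) -> Ck k O f -> Ck k O g.
Proof.
move=> oO; elim: k f g => [|k IH] f g fg [cf df].
  split=> // x Ox; apply: continuous_near (cf x Ox).
  by apply: filterS (open_nbhs_nbhs (conj oO Ox)) => y /fg.
have fgn x : O x -> \forall y \near x, f y = g y.
  by move=> Ox; apply: filterS (open_nbhs_nbhs (conj oO Ox)) => y /fg.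
split=> [x Ox|i]; first exact: continuous_near (fgn x Ox) (cf x Ox).
have [dfi Ci] := df i; split=> [x Ox|].
  by have [l fl] := dfi x Ox; exists l; apply: is_partial_near fl; exact: fgn.
by apply: IH Ci => x Ox; apply: partial_near; exact: fgn.
Qed.

(** [partial] is a chosen limit; in a Hausdorff space any explicit formula [df] for the derivatives
    on the open set may replace it. *)
Lemma CkSI k O f (df : 'I_n -> 'rV[R]_n -> W) : hausdorff_space W -> open O ->
  (forall x, O x -> {for x, continuous f}) ->
  (forall i x, O x -> is_partial i f x (df i x)) ->
  (forall i, Ck k O (df i)) -> Ck k.+1 O f.
Proof.
move=> hW oO cf dfE Cdf; split=> // i; split.
  by move=> x Ox; exists (df i x); exact: dfE.
by apply: Ck_eq (Cdf i) => // x Ox; rewrite (partialE hW (dfE i x Ox)).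
Qed.

Lemma Ck_is_partial k O f i x : hausdorff_space W -> Ck k.+1 O f -> O x ->
  is_partial i f x (partial j i f x).
Proof.
by move=> hW [_ /(_ i)[df _]] /df[l fl]; rewrite (partialE hW fl).
Qed.

Lemma is_partialD i f g x l m : is_partial i f x l -> is_partial i g x m ->
  is_partial i (fun y => f y + g y) x (l + m).
Proof.
move=> fl gm; rewrite /is_partial.
rewrite (_ : diff_quot _ _ _ _ = fun h => diff_quot j i f x h + diff_quot j i g x h).
  exact: tvs_cvgD.
by apply/funext => h; rewrite /diff_quot -scalerDr opprD addrACA.
Qed.

Lemma is_partial_cst i (c : W) x : is_partial i (fun=> c) x 0.
Proof.
rewrite /is_partial (_ : diff_quot _ _ _ _ = fun=> 0); first exact: cvg_cst.
by apply/funext => h; rewrite /diff_quot subrr scaler0.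
Qed.

Lemma is_partial_sum (I : Type) (r : seq I) (F : I -> 'rV[R]_n -> W) (l : I -> W) i x :
  (forall u, is_partial i (F u) x (l u)) ->
  is_partial i (fun y => \sum_(u <- r) F u y) x (\sum_(u <- r) l u).
Proof.
move=> Fl; elim: r => [|u r IH].
  rewrite big_nil (_ : (fun y => _) = fun=> 0); first exact: is_partial_cst.
  by apply/funext => y; rewrite big_nil.
rewrite big_cons (_ : (fun y => _) = fun y => F u y + \sum_(v <- r) F v y).
  exact: is_partialD.
by apply/funext => y; rewrite big_cons.
Qed.

Lemma Ck_cst k O (c : W) : hausdorff_space W -> open O -> Ck k O (fun=> c).
Proof.
move=> hW oO; elim: k c => [|k IH] c; first by split=> // x _; exact: cst_continuous.
apply: (CkSI (df := fun _ _ => 0)) => //.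
- by move=> x _; exact: cst_continuous.
- by move=> i x _; exact: is_partial_cst.
Qed.

Lemma CkD k O f g : hausdorff_space W -> open O -> Ck k O f -> Ck k O g ->
  Ck k O (fun y => f y + g y).
Proof.
move=> hW oO; elim: k f g => [|k IH] f g Cf Cg.
  by split=> // x Ox; apply: tvs_continuousD; [exact: Ck_continuous Cf Ox|exact: Ck_continuous Cg Ox].
apply: (CkSI (df := fun i y => partial j i f y + partial j i g y)) => //.
- by move=> x Ox; apply: tvs_continuousD; [exact: Ck_continuous Cf Ox|exact: Ck_continuous Cg Ox].
- by move=> i x Ox; apply: is_partialD; apply: Ck_is_partial; eauto.
- by case: Cf => _ Cf; case: Cg => _ Cg i; apply: IH; [case: (Cf i)|case: (Cg i)].
Qed.

Lemma Ck_sum k O (I : Type) (r : seq I) (F : I -> 'rV[R]_n -> W) : hausdorff_space W -> open O ->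
  (forall m, Ck k O (F m)) -> Ck k O (fun y => \sum_(m <- r) F m y).
Proof.
move=> hW oO CF; elim: r => [|i r IH].
  by apply: Ck_eq (Ck_cst k 0 hW oO) => // x _; rewrite big_nil.
by apply: Ck_eq (CkD hW oO (CF i) IH) => // x _; rewrite big_cons.
Qed.

(** Discrete Leibniz rule with [f] taken at [x] and [a] at the shifted point, so that the continuity
    used is that of [a]. *)
Lemma is_partialZ i (a : 'rV[R]_n -> K^o) f x (b : K^o) l : {for x, continuous a} ->
  diff_quot j i a x @ 0^' --> b -> is_partial i f x l ->
  is_partial i (fun y => (a y : K) *: f y) x ((b : K) *: f x + (a x : K) *: l).
Proof.
move=> ca ab fl; rewrite /is_partial.
have -> : diff_quot j i (fun y => (a y : K) *: f y) x = fun h =>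
    (diff_quot j i a x h : K) *: f x +
    (a (x + h *: delta_mx 0 i) : K) *: diff_quot j i f x h.
  apply/funext => h; rewrite /diff_quot scalerA [_ * j _]mulrC -scalerA.
  rewrite -scalerA -scalerDr; congr (_ *: _).
  by rewrite [RHS]addrC scalerBl scalerBr addrA subrK.
apply: tvs_cvgD; first exact: tvs_cvgZr.
by apply: tvs_cvgZ => //; exact: (cvg_comp _ _ (@line_cvg _ _ x i) ca).
Qed.

End PartialDerivatives.

(** * Products and linear images of smooth functions *)

Section Products.
Context {R : realType} {K : numFieldType} (j : {rmorphism R -> K}).
Context {W : tvsType K} {n : nat} (hW : hausdorff_space W).

Lemma CkZ k (O : set 'rV[R]_n) (a : 'rV[R]_n -> K^o) (f : 'rV[R]_n -> W) : open O ->
  Ck j k O a -> Ck j k O f -> Ck j k O (fun y => (a y : K) *: f y).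
Proof.
move=> oO; elim: k a f => [|k IH] a f Ca Cf.
  by split=> // x Ox; apply: tvs_continuousZ; [exact: Ck_continuous Ca Ox|exact: Ck_continuous Cf Ox].
have hK : hausdorff_space K^o by exact: norm_hausdorff.
apply: (CkSI (df := fun i y => (partial j i a y : K) *: f y + (a y : K) *: partial j i f y)) => //.
- by move=> x Ox; apply: tvs_continuousZ; [exact: Ck_continuous Ca Ox|exact: Ck_continuous Cf Ox].
- move=> i x Ox; apply: is_partialZ; first exact: Ck_continuous Ca Ox.
    exact: (Ck_is_partial hK Ca).
  exact: (Ck_is_partial hW Cf).
- move=> i; have [_ /(_ i)[_ Ca']] := Ca; have [_ /(_ i)[_ Cf']] := Cf.
  by apply: CkD => //; apply: IH => //; exact: CkS.
Qed.

Lemma smooth_onZ (O : set 'rV[R]_n) (a : 'rV[R]_n -> K^o) (f : 'rV[R]_n -> W) : open O ->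
  smooth_on j O a -> smooth_on j O f -> smooth_on j O (fun y => (a y : K) *: f y).
Proof.
move=> oO /smooth_on_Ck Ca /smooth_on_Ck Cf; apply/smooth_on_Ck => k.
exact: CkZ.
Qed.

End Products.

Section LinearImage.
Context {R : realType} {K1 K2 : numFieldType} (j1 : {rmorphism R -> K1}) (j2 : {rmorphism R -> K2}).
Context {W1 : tvsType K1} {W2 : tvsType K2} {n : nat}.
Hypotheses (hW1 : hausdorff_space W1) (hW2 : hausdorff_space W2).
Variable L : W1 -> W2.
Hypotheses (LB : forall x y, L (x - y) = L x - L y)
  (LZ : forall (r : R) x, L (j1 r *: x) = j2 r *: L x) (Lc : continuous L).

(** Homogeneity over [R], through [j1] and [j2], lets [L] change the scalar field. The section
    serves coordinates with values in [R[i]], the embedding of [R] into [R[i]], and the inclusion of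
    a disk space into [V]. *)
Lemma is_partial_linear i (f : 'rV[R]_n -> W1) x l : is_partial j1 i f x l ->
  is_partial j2 i (L \o f) x (L l).
Proof.
move=> fl; rewrite /is_partial (_ : diff_quot _ _ _ _ = L \o diff_quot j1 i f x).
  by apply: cvg_comp fl _; exact: Lc.
by apply/funext => h; rewrite /diff_quot/= LZ LB.
Qed.

Lemma partials_linear s (O : set 'rV[R]_n) (f : 'rV[R]_n -> W1) x : open O ->
  smooth_on j1 O f -> O x -> partials j2 s (L \o f) x = L (partials j1 s f x).
Proof.
move=> oO sf; elim: s x => [//|i s IH] x Ox /=.
have -> : partial j2 i (partials j2 s (L \o f)) x = partial j2 i (L \o partials j1 s f) x.
  by apply: partial_near; apply: filterS (open_nbhs_nbhs (conj oO Ox)) => y /IH.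
apply: partialE => //; apply: is_partial_linear.
exact: smooth_on_is_partial (smooth_on_partials s sf) Ox.
Qed.

Lemma smooth_on_linear (O : set 'rV[R]_n) (f : 'rV[R]_n -> W1) : open O ->
  smooth_on j1 O f -> smooth_on j2 O (L \o f).
Proof.
move=> oO sf s x Ox; have sfs := smooth_on_partials s sf.
have nE : \forall y \near x, (L \o partials j1 s f) y = partials j2 s (L \o f) y.
  apply: filterS (open_nbhs_nbhs (conj oO Ox)) => y Oy.
  by rewrite (partials_linear s oO).
split.
  apply: continuous_near nE _; apply: continuous_comp; last exact: Lc.
  exact: smooth_on_continuous sfs Ox.
move=> i; exists (L (partial j1 i (partials j1 s f) x)).
apply: is_partial_near nE _; apply: is_partial_linear.
exact: smooth_on_is_partial sfs Ox.
Qed.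

End LinearImage.

(** * Differentiability in several variables and the chain rule *)

Section StrongDifferentiability.
Context {R : realType} {V : tvsType R[i]} {p : nat}.
Notation rc := (real_complex R).
Implicit Types (f : 'rV[R]_p -> V) (z w : 'rV[R]_p).

Lemma mean_value_segment (g : R -> V) (w : R) D : convex_set (M := V) D ->
  (forall t, `|t| <= `|w| -> exists2 l : V, nbhs l D &
     (fun h : R => (h^-1)%:C *: (g (t + h) - g t)) @ 0^' --> l) ->
  exists2 q, D q & g w - g 0 = w%:C *: q.
Proof.
move=> cD hg; have [w0|w0] := leP 0 w.
  have [t /andP[t0 tw]|q Dq] := mean_value w0 cD (g := g).
    by apply: hg; rewrite !ger0_norm.
  by rewrite subr0; exists q.
have [t /andP[wt t0]|q Dq] := mean_value (ltW w0) cD (g := g).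
  by apply: hg; rewrite !ler0_norm ?(ltW w0)// lerN2.
by rewrite sub0r => gq; exists q => //; rewrite -opprB gq rmorphN scaleNr opprK.
Qed.

(* Change the coordinates one at a time. *)
Lemma increment_coords f z w (D : 'I_p -> set V) : (forall k, convex_set (M := V) (D k)) ->
  (forall z', (forall k, `|z' ord0 k - z ord0 k| <= `|w ord0 k|) ->
    forall k, exists2 l : V, nbhs l (D k) & is_partial rc k f z' l) ->
  exists2 q : 'I_p -> V, (forall k, D k (q k)) &
    f (z + w) - f z = \sum_k (w ord0 k)%:C *: q k.
Proof.
move=> cD hf; pose tr m : 'rV[R]_p := \row_k (if (k < m)%N then w ord0 k else 0).
have /choice[q qP] : forall k : 'I_p, exists q, D k q /\
    f (z + tr k.+1) - f (z + tr k) = (w ord0 k)%:C *: q.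
  move=> k; pose g t := f (z + tr k + t *: delta_mx 0 k).
  have [t tw|q Dq gq] := @mean_value_segment g (w ord0 k) (D k) (cD k).
    have [k'|l lD fl] := hf (z + tr k + t *: delta_mx 0 k) _ k.
      rewrite !mxE eqxx/= -addrA [z _ _ + _]addrC addrK.
      have [->|kk'] := eqVneq k' k; first by rewrite ltnn add0r mulr1.
      by rewrite mulr0 addr0; case: ifP; rewrite ?normr0.
    exists l => //; rewrite (_ : (fun h => _) = diff_quot rc k f (z + tr k + t *: delta_mx 0 k))//.
    by apply/funext => h; rewrite /diff_quot /g scalerDl addrA.
  exists q; split => //; rewrite -gq /g scale0r addr0; congr (f _ - _).
  rewrite -addrA; congr (_ + _); apply/rowP => k'; rewrite !mxE eqxx/=.
  have [->|kk'] := eqVneq k' k; first by rewrite ltnSn ltnn mulr1 add0r.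
  by rewrite mulr0 addr0 ltnS leq_eqVlt (inj_eq val_inj) (negbTE kk').
exists q => [k|]; first by case: (qP k).
have tr0 : tr 0%N = 0 by apply/rowP => k; rewrite !mxE.
have trp : tr p = w by apply/rowP => k; rewrite !mxE ltn_ord.
have := telescope_sumr (fun m => f (z + tr m)) (leq0n p).
rewrite /= tr0 trp addr0 => <-; rewrite big_mkord.
by apply: eq_bigr => k _; case: (qP k).
Qed.

(** Balls of row vectors are boxes, hence contain the paths that change one coordinate at a time. *)
Lemma near_box z (A : set 'rV[R]_p) : nbhs z A -> \forall w \near (0 : 'rV[R]_p),
  forall z', (forall k, `|z' ord0 k - z ord0 k| <= `|(w : 'rV[R]_p) ord0 k|) -> A z'.
Proof.
move=> /nbhs_ballP[e e0 eA]; apply/nbhs_ballP; exists e => // w [_ ew] z' hz.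
apply: eA; split=> // i k; rewrite ord1 /ball/= distrC.
apply: le_lt_trans (hz k) _.
by have := ew ord0 k; rewrite /ball/= mxE sub0r normrN.
Qed.

(** On a small box the [k]-th derivative stays interior to the translate of [D] by its value at [z],
    and translates of [D] are convex. The increment [w] is arbitrary, not along an axis, so that an
    increment of an inner function can be substituted for it. *)
Lemma strong_differentiability f z : (forall k, \forall z' \near z, is_partial rc k f z' (partial rc k f z')) ->
  (forall k, {for z, continuous (partial rc k f)}) ->
  forall D, nbhs (0 : V) D -> absconvex D -> \forall w \near (0 : 'rV[R]_p),
    exists2 q : 'I_p -> V, (forall k, D (q k - partial rc k f z)) &
      f (z + w) - f z = \sum_k ((w : 'rV[R]_p) ord0 k)%:C *: q k.
Proof.
move=> df cf D D0 aD.
have : \forall z' \near z, forall k, is_partial rc k f z' (partial rc k f z') /\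
    nbhs (partial rc k f z') [set x | D (x - partial rc k f z)].
  apply: (@filter_forall _ _ _ (nbhs z)) => k; apply: filterI; first exact: df.
  exact: (cf k _ (nbhs_interior (nbhs_absconvex_translate _ D0))).
move=> /near_box; apply: filterS => w hw.
apply: (@increment_coords f z w (fun k => [set x | D (x - partial rc k f z)])).
  by move=> k; apply: convex_translate; case: aD.
by move=> z' /hw h k; have [? ?] := h k; exists (partial rc k f z').
Qed.

Lemma dilate_sum (I : Type) (r : seq I) (c : I -> R[i]) (B : I -> R) (d : I -> V) D :
  absconvex D -> (forall k, `|c k| <= (B k)%:C) -> (forall k, 0 <= B k) -> (forall k, D (d k)) ->
  dilate (\sum_(k <- r) B k) D (\sum_(k <- r) c k *: d k).
Proof.
move=> aD cB B0 Dd; elim: r => [|k r IH].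
  by rewrite !big_nil; exists 0; [case: aD|rewrite scaler0].
rewrite !big_cons; apply: dilateD => //; first by case: aD.
  by apply: sumr_ge0.
rewrite -[B k]mulr1; apply: dilate_circled => //.
by rewrite dilate1.
Qed.

End StrongDifferentiability.

Section ChainRule.
Context {R : realType} {V : tvsType R[i]} {n p : nat} (hV : hausdorff_space V).
Notation rc := (real_complex R).
Variables (O : set 'rV[R]_n) (O' : set 'rV[R]_p) (phi : 'rV[R]_n -> 'rV[R]_p).
Hypotheses (oO : open O) (oO' : open O') (phiO : forall y, O y -> O' (phi y)).
Hypothesis sphi : smooth_on idfun O phi.

Let hrV q : hausdorff_space 'rV[R]_q. Proof. exact: norm_hausdorff. Qed.

(** With the increment of [phi] substituted for [w], the error splits in two: bounded coefficients
    times errors in [E], and the convergence of the coefficients to the entries of [l]. *)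
Lemma is_partial_comp (f : 'rV[R]_p -> V) i x (l : 'rV[R]_p) :
  (forall k, \forall z \near phi x, is_partial rc k f z (partial rc k f z)) ->
  (forall k, {for phi x, continuous (partial rc k f)}) ->
  {for x, continuous phi} -> is_partial idfun i phi x l ->
  is_partial rc i (f \o phi) x (\sum_k (l ord0 k)%:C *: partial rc k f (phi x)).
Proof.
move=> df cf cphi dphi; apply/cvg_diskP => D0 D00 aD0.
have [D [D0n aD DD DDD]] := nbhs_absconvex_half D00.
(* Near 0 the [k]-th coefficient has modulus at most [|l_k| + 1], so errors in [E = M^-1 D] sum up
   to an element of [D]. The leading 1 keeps [M] positive when [p = 0]. *)
pose M : R := 1 + \sum_k (`|l ord0 k| + 1).
have M0 : 0 < M by rewrite ltr_wpDr// sumr_ge0// => k _; rewrite addr_ge0.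
have Mn0 : M^-1 != 0 by rewrite invr_eq0 gt_eqF//.
pose E := dilate M^-1 D.
have En : nbhs (0 : V) E by exact: nbhs_dilate.
have aE : absconvex E by exact: absconvex_dilate.
have sd := strong_differentiability df cf En aE.
have wphi : (fun h : R => phi (x + h *: delta_mx 0 i) - phi x) @ 0^' --> (0 : 'rV[R]_p).
  rewrite -(subrr (phi x)); apply: tvs_cvgB; last exact: cvg_cst.
  exact: (cvg_comp _ _ (@line_cvg _ _ x i) cphi).
have wl k : (fun h : R => (diff_quot idfun i phi x h) ord0 k) @ 0^' --> l ord0 k.
  exact: (cvg_comp _ _ dphi (@coord_continuous _ _ _ ord0 k l)).
have S1 : \forall h \near (0 : R)^', forall k, `|(diff_quot idfun i phi x h) ord0 k| <= `|l ord0 k| + 1.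
  apply: filter_forall => k; have /cvgrPdist_le/(_ 1 ltr01) := wl k.
  apply: filterS => h hl; rewrite -lerBlDl; apply: le_trans (lerB_dist _ _) _.
  by rewrite distrC.
have S2 : \forall h \near (0 : R)^',
    D (\sum_k (((diff_quot idfun i phi x h) ord0 k)%:C *: partial rc k f (phi x))
      - \sum_k (l ord0 k)%:C *: partial rc k f (phi x)).
  have : (fun h : R => \sum_(k <- index_enum 'I_p) (((diff_quot idfun i phi x h) ord0 k)%:C *: partial rc k f (phi x)))
      @ 0^' --> \sum_(k <- index_enum 'I_p) (l ord0 k)%:C *: partial rc k f (phi x).
    apply: tvs_cvg_sum => k _; apply: (tvs_cvgZr (s := fun h : R => (diff_quot idfun i phi x h ord0 k)%:C : R[i]^o)).
    exact: (cvg_comp _ _ (wl k) (@real_complex_continuous R (l ord0 k))).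
  by move=> /cvg_diskP; apply.
have S3 := wphi _ sd.
apply: filterS3 S1 S2 S3 => h h1 h2 [q Eq fq].
rewrite {1}/diff_quot/= -[phi (x + _)](subrK (phi x)) [X in f X]addrC fq scaler_sumr.
have -> : \sum_k rc h^-1 *: ((((phi (x + h *: delta_mx 0 i) - phi x) ord0 k)%:C) *: q k) =
   \sum_k ((diff_quot idfun i phi x h) ord0 k)%:C *: (q k - partial rc k f (phi x)) +
   \sum_k (((diff_quot idfun i phi x h) ord0 k)%:C *: partial rc k f (phi x)).
  rewrite -big_split/=; apply: eq_bigr => k _; rewrite -scalerDr subrK scalerA -rmorphM.
  by rewrite /diff_quot !mxE.
rewrite -addrA; apply: DDD h2.
set S := \sum_k _; have : dilate M E S.
  apply: dilate_le (aE) _ _ _ (dilate_sum (B := fun k => `|l ord0 k| + 1) (index_enum 'I_p) aE _ _ Eq).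
  - by apply: sumr_ge0 => k _; rewrite addr_ge0.
  - by rewrite lerDr.
  - by move=> k; rewrite normc_real lecR; exact: h1.
  - by move=> k; rewrite addr_ge0.
by case=> _ [u Du <-] <-; rewrite scalerA -rmorphM/= divff ?gt_eqF// scale1r.
Qed.

Lemma coord_smooth k s : smooth_on rc O (fun y => ((partials idfun s phi y ord0 k)%:C : R[i]^o)).
Proof.
apply: (@smooth_on_linear R R R[i] idfun rc 'rV[R]_p (R[i]^o) n _ _ (fun v => (v ord0 k)%:C)).
- exact: hrV.
- exact: norm_hausdorff.
- by move=> u v; rewrite !mxE rmorphB.
- by move=> r u; rewrite !mxE rmorphM.
- move=> v; apply: continuous_comp; first exact: coord_continuous.
  exact: real_complex_continuous.
- exact: oO.
- exact: smooth_on_partials.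
Qed.

Lemma smooth_is_partial_comp (f : 'rV[R]_p -> V) i x : smooth_on rc O' f -> O x ->
  is_partial rc i (f \o phi) x
    (\sum_k (partial idfun i phi x ord0 k)%:C *: partial rc k f (phi x)).
Proof.
move=> sf Ox; apply: is_partial_comp.
- move=> k; apply: filterS (open_nbhs_nbhs (conj oO' (phiO Ox))) => z O'z.
  exact: smooth_on_is_partial sf O'z.
- move=> k; apply: (smooth_on_continuous (smooth_on_partials [:: k] sf)).
  exact: phiO.
- exact: smooth_on_continuous sphi Ox.
- exact: smooth_on_is_partial sphi Ox.
Qed.

(** A Faa di Bruno formula that records only what is needed: the coefficients are smooth and
    independent of [f], and orders do not grow. Independence of [f] gives bounds uniform over a
    family of orbit maps. The weight [h], later a cutoff, is simply the coefficient of the empty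
    word. *)
Lemma partials_weighted_comp (h : 'rV[R]_n -> R[i]^o) : smooth_on rc O h ->
  forall s, exists (I : finType) (a : I -> 'rV[R]_n -> R[i]^o) (t : I -> seq 'I_p),
  (forall u, smooth_on rc O (a u) /\ (size (t u) <= size s)%N) /\
  forall f : 'rV[R]_p -> V, smooth_on rc O' f -> forall y, O y ->
    partials rc s (fun y => (h y : R[i]) *: f (phi y)) y =
    \sum_u (a u y : R[i]) *: partials rc (t u) f (phi y).
Proof.
move=> sh; elim=> [|i s [I [a [t [aP aE]]]]].
  exists 'I_1, (fun=> h), (fun=> [::]); split=> [u|f sf y Oy].
    by split; [exact: sh|exact: leqnn].
  by rewrite big_ord1.
pose dphi m y : R[i]^o := (partial idfun i phi y ord0 m)%:C.
(* In a term of the formula for [s], [inl] differentiates the coefficient; [inr] differentiates the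
   composite, which adds the letter [m] and the factor given by the [m]-th entry of the derivative
   of [phi]. *)
exists (I + I * 'I_p)%type,
  (fun u => match u with inl u => partial rc i (a u)
     | inr um => fun y => (a um.1 y : R[i]) *: dphi um.2 y end),
  (fun u => match u with inl u => t u | inr um => um.2 :: t um.1 end).
split.
  case=> [u|[u m]]; have [su tu] := aP u; split.
  - exact: (smooth_on_partials [:: i] su).
  - exact: leqW.
  - apply: (smooth_onZ (@norm_hausdorff _ R[i]^o) oO su).
    exact: (coord_smooth m [:: i]).
  - exact: tu.
move=> f sf y Oy.
have -> : partials rc (i :: s) (fun y => (h y : R[i]) *: f (phi y)) y =
   partial rc i (fun y => \sum_u (a u y : R[i]) *: partials rc (t u) f (phi y)) y.
  by apply: partial_near; apply: filterS (open_nbhs_nbhs (conj oO Oy)) => z /(aE f sf).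
apply: (partialE hV); rewrite big_sumType/=.
rewrite -(pair_bigA _ (fun u m => ((a u y : R[i]) *: dphi m y : R[i]) *:
  partials rc (m :: t u) f (phi y))) -big_split/=.
apply: is_partial_sum => u; have [su _] := aP u.
have sfu := smooth_on_partials (t u) sf.
have -> : \sum_m ((a u y : R[i]) *: dphi m y : R[i]) *: partials rc (m :: t u) f (phi y) =
    (a u y : R[i]) *: \sum_m (partial idfun i phi y ord0 m)%:C *: partial rc m (partials rc (t u) f) (phi y).
  by rewrite scaler_sumr; apply: eq_bigr => m _; rewrite scalerA.
apply: (is_partialZ (smooth_on_continuous su Oy)).
  exact: (smooth_on_is_partial (@norm_hausdorff _ R[i]^o) su Oy).
exact: smooth_is_partial_comp.
Qed.

End ChainRule.

(** * Smooth functions with values in the span of a disk *)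

Section DiskSpaces.
Context {R : realType} {V : tvsType R[i]} (T : disk V).
Notation rc := (real_complex R).

Lemma absconvex_disk : absconvex (disk_set T).
Proof. by split; [exact: disk0|move=> a x; exact: disk_circled|exact: disk_convex]. Qed.

Lemma dilate_span r x : dilate r (disk_set T) x -> x \in disk_span T.
Proof. by move=> [y Ty <-]; apply/asboolP; exists r%:C, y. Qed.

Lemma disk_norm_le r (u : disk_space T) : 0 <= r -> dilate r (disk_set T) (val u) -> `|u| <= r%:C.
Proof. by move=> r0 [y Ty yu]; rewrite lecR; apply: gauge_le r0 Ty _. Qed.

(** The inequality is strict because the infimum defining the gauge need not be attained. *)
Lemma disk_norm_lt r (u : disk_space T) : `|u| < r%:C -> dilate r (disk_set T) (val u).
Proof.
rewrite ltcR => /(gauge_lt (valP u))[s /andP[s0 sr] [y Ty uy]].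
by apply: dilate_le absconvex_disk s0 (ltW sr) _ _; exists y.
Qed.

Lemma disk_valB (u v : disk_space T) : val (u - v) = val u - val v.
Proof. by rewrite raddfB. Qed.

Lemma disk_valZ (a : R[i]) (u : disk_space T) : val (a *: u) = a *: val u.
Proof. by []. Qed.

Lemma closed_approx (A : set V) x : closed A ->
  (forall D, nbhs (0 : V) D -> absconvex D -> exists2 a, A a & D (x - a)) -> A x.
Proof.
move=> Acl h; apply: Acl => B /nbhs_shift /nbhs_absconvex[D [D0 aD DB]].
have [a Aa Dxa] := h D D0 aD; exists a; split=> //.
by have := DB _ (absconvexN aD Dxa); rewrite /= opprB addrC subrK.
Qed.

Hypothesis clT : closed (disk_set T).

(** The mean value theorem wants derivatives interior to a convex set, and a multiple of [T] may
    have empty interior; thickened by [U] it is a neighbourhood of each of its points in [M T]. As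
    the estimate holds for every [U], closedness of [T] removes the thickening. *)
Lemma closed_disk_approx (r M : R) x : 0 <= r -> 0 < M ->
  (forall U, nbhs (0 : V) U -> absconvex U ->
    dilate r [set a + u | a in dilate M (disk_set T) & u in U] x) ->
  dilate (r * M) (disk_set T) x.
Proof.
move=> r0 M0 h; have [r00|rn0] := eqVneq r 0.
  have [|z _ <-] := h setT filterT.
    by split=> //; apply: convex_setI.
  by rewrite r00 mul0r scale0r; exists 0; [exact: disk0|rewrite scale0r].
have rM0 : (r * M)%:C != 0 by rewrite fmorph_eq0 mulf_neq0// gt_eqF.
exists ((r * M)%:C^-1 *: x); last by rewrite scalerA divff// scale1r.
apply: closed_approx clT _ => D D0 aD.
have [||_ [_ [t Tt <-] [_ [d Dd <-] <-]] <-] := h (dilate M D).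
- by apply: nbhs_dilate => //; rewrite gt_eqF.
- exact: absconvex_dilate.
exists t => //; rewrite -scalerDr (scalerA r%:C) -rmorphM/= scalerA mulVf// scale1r.
by rewrite addrC addKr.
Qed.

End DiskSpaces.

Lemma mx_norm_entry (R : realType) n (w : 'rV[R]_n) k : `|w ord0 k| <= `|w|.
Proof.
rewrite [leRHS](_ : _ = mx_norm w)// mx_normrE.
exact: (le_bigmax _ (fun ij : 'I_1 * 'I_n => `|w ij.1 ij.2|) (ord0, k)).
Qed.

Section LiftSmooth.
Context {R : realType} {V : tvsType R[i]} (hV : hausdorff_space V).
Variables (T : disk V) (clT : closed (disk_set T)).
Notation rc := (real_complex R).
Context {n : nat}.
Implicit Types (f : 'rV[R]_n -> V) (O : set 'rV[R]_n) (x : 'rV[R]_n).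

Lemma increment_bound f x (M : R) : 0 < M ->
  (forall k, \forall y \near x, is_partial rc k f y (partial rc k f y)) ->
  (forall k, \forall y \near x, dilate M (disk_set T) (partial rc k f y)) ->
  exists2 C : R, 0 < C & \forall w \near (0 : 'rV[R]_n),
    dilate (C * `|w : 'rV[R]_n|) (disk_set T) (f (x + w) - f x).
Proof.
move=> M0 df bf; have aT := absconvex_disk T.
(* The sum of the moduli of the entries of [w] is at most [n] times its norm; [n.+1] keeps the
   constant positive when [n = 0]. *)
exists (n.+1%:R * M); first by rewrite mulr_gt0.
have : \forall y \near x, forall k, is_partial rc k f y (partial rc k f y) /\
    dilate M (disk_set T) (partial rc k f y).
  by apply: (@filter_forall _ _ _ (nbhs x)) => k; apply: filterI; [exact: df|exact: bf].
move=> /near_box; apply: filterS => w hw.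
have sw : \sum_k `|w ord0 k| <= n.+1%:R * `|w|.
  rewrite (@le_trans _ _ (\sum_(k < n) `|w|))//.
    by apply: ler_sum => k _; exact: mx_norm_entry.
  by rewrite sumr_const card_ord -[leLHS]mulr_natl ler_wpM2r// ler_nat.
have s0 : 0 <= \sum_k `|w ord0 k| by exact: sumr_ge0.
have : dilate ((\sum_k `|w ord0 k|) * M) (disk_set T) (f (x + w) - f x).
  apply: (closed_disk_approx clT) => // U U0 aU.
  have aD : absconvex [set a + u | a in dilate M (disk_set T) & u in U].
    by apply: absconvex_add => //; exact: absconvex_dilate.
  have [||q Dq ->] := @increment_coords _ _ _ f x w
      (fun=> [set a + u | a in dilate M (disk_set T) & u in U]).
  - by case: aD.
  - move=> z /hw h k; have [dz bz] := h k; exists (partial rc k f z) => //.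
    apply: filterS (nbhs_absconvex_translate (partial rc k f z) U0) => y Uy.
    by exists (partial rc k f z) => //; exists (y - partial rc k f z); rewrite // addrC subrK.
  apply: dilate_sum => // k.
  by rewrite normc_real.
apply: dilate_le => //; first by rewrite mulr_ge0// ltW.
by rewrite mulrAC ler_wpM2r// ltW.
Qed.

(** The multiple [M] and the neighbourhood may depend on the word [s], the disk [T] may not. *)
Definition locally_disk_bounded O f := forall s x, O x -> exists2 M : R, 0 < M &
  \forall y \near x, dilate M (disk_set T) (partials rc s f y).

Definition disk_lift (f : 'rV[R]_n -> V) : 'rV[R]_n -> disk_space T := fun y => insubd 0 (f y).

Lemma disk_liftK f y : f y \in disk_span T -> val (disk_lift f y) = f y.
Proof. by move=> fy; rewrite val_insubd fy. Qed.

Section SmoothLift.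
Variable O : set 'rV[R]_n.
Hypothesis oO : open O.

Let near_O x : O x -> \forall y \near x, O y.
Proof. by move=> Ox; exact: open_nbhs_nbhs. Qed.

Lemma locally_disk_bounded_partials f s : locally_disk_bounded O f ->
  locally_disk_bounded O (partials rc s f).
Proof.
move=> bf t x Ox; have := bf (t ++ s) x Ox.
by rewrite (_ : partials rc (t ++ s) f = partials rc t (partials rc s f))// /partials foldr_cat.
Qed.

Lemma locally_disk_bounded_span f x : locally_disk_bounded O f -> O x -> f x \in disk_span T.
Proof. by move=> bf /(bf [::])[M _ /nbhs_singleton/dilate_span]. Qed.

Lemma smooth_increment f x : smooth_on rc O f -> locally_disk_bounded O f -> O x ->
  exists2 C : R, 0 < C & \forall w \near (0 : 'rV[R]_n),
    dilate (C * `|w : 'rV[R]_n|) (disk_set T) (f (x + w) - f x).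
Proof.
move=> sf bf Ox.
have : forall k : 'I_n, exists M : R, 0 < M /\
    \forall y \near x, dilate M (disk_set T) (partial rc k f y).
  by move=> k; have [M M0 h] := bf [:: k] x Ox; exists M.
move=> /choice[M MP].
have M0 k : 0 <= M k by case: (MP k) => /ltW.
apply: (@increment_bound f x (1 + \sum_k M k)).
- by rewrite ltr_wpDr// sumr_ge0.
- by move=> k; apply: filterS (near_O Ox) => y; exact: smooth_on_is_partial.
- move=> k; have [_] := MP k; apply: filterS => y; apply: dilate_le => //.
    exact: absconvex_disk.
  by rewrite (bigD1 k)//= addrCA lerDl addr_ge0// sumr_ge0.
Qed.

(** Continuity for the gauge is not inherited from [V]; it comes from the Lipschitz estimate that
    the bounds on first derivatives provide. *)
Lemma disk_lift_continuous f x : smooth_on rc O f -> locally_disk_bounded O f -> O x ->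
  {for x, continuous (disk_lift f)}.
Proof.
move=> sf bf Ox; have [C C0 hC] := smooth_increment sf bf Ox.
apply/(@cvgrPdist_lt _ _ _ (nbhs x) (nbhs_filter x)) => e /gtc0_real[r r0 ->].
have hx : \forall y \near x, dilate (C * `|y - x|) (disk_set T) (f y - f x).
  apply/nbhs_shift; apply: filterS hC => w /=.
  by rewrite [x + w - x]addrC addKr.
have hr : \forall y \near x, C * `|y - x| < r.
  have : \forall y \near x, `|x - y| < r / C.
    by apply: (@cvgr_dist_lt _ _ _ (nbhs x) _ id) => //; rewrite divr_gt0.
  by apply: filterS => y; rewrite distrC ltr_pdivlMr// mulrC.
apply: filterS3 hx hr (near_O Ox) => y hy ry Oy.
rewrite distrC; apply: le_lt_trans (disk_norm_le (r := C * `|y - x|) _ _) _.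
- by rewrite mulr_ge0// ltW.
- by rewrite disk_valB !disk_liftK//; exact: locally_disk_bounded_span bf _.
- by rewrite ltcR.
Qed.

(** The mean value theorem is applied to the remainder [g t = f (x + t e_i) - t f_i x], where [f_i]
    is the partial derivative. Its derivative [f_i (x + t e_i) - f_i x] lies in a multiple of [T]
    proportional to [|t|], by the Lipschitz estimate for [f_i]; so the remainder is quadratic in [h]
    for the gauge. *)
Lemma disk_lift_is_partial f i x : smooth_on rc O f -> locally_disk_bounded O f -> O x ->
  is_partial rc i (disk_lift f) x (disk_lift (partial rc i f) x).
Proof.
move=> sf bf Ox; have sfi := smooth_on_partials [:: i] sf.
have bfi := locally_disk_bounded_partials [:: i] bf.
have aT := absconvex_disk T.
have [C C0 hC] := smooth_increment sfi bfi Ox.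
(* [E] converts the norm of [t e_i] into a multiple of [|t|]; the summand 1 gives positivity at
   once. *)
pose E : R := `|delta_mx 0 i : 'rV[R]_n| + 1.
have E0 : 0 < E by rewrite ltr_wpDl.
have CE0 : 0 < C * E by rewrite mulr_gt0.
have [d d0 hd] : exists2 d : R, 0 < d & forall t : R, `|t| < d ->
    O (x + t *: delta_mx 0 i) /\
    dilate (C * E * `|t|) (disk_set T) (partial rc i f (x + t *: delta_mx 0 i) - partial rc i f x).
  have hw : \forall w \near (0 : 'rV[R]_n), O (x + w) /\
      dilate (C * `|w|) (disk_set T) (partials rc [:: i] f (x + w) - partials rc [:: i] f x).
    by apply: filterI hC; apply: (iffLR (nbhs_shift x O)); exact: near_O.
  have : (fun t : R => t *: delta_mx 0 i : 'rV[R]_n) @ (0 : R) --> (0 : R) *: (delta_mx 0 i : 'rV[R]_n).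
    by apply: (tvs_cvgZr (s := fun h : R => h : R^o)); exact: cvg_id.
  rewrite scale0r => /(_ _ hw); rewrite nbhs_filterE/= => /nbhs_ballP[d d0 hd].
  exists d => // t td; have [|Ot bt] := hd t; first by rewrite /ball/= sub0r normrN.
  split => //; apply: dilate_le bt => //; first by rewrite mulr_ge0// ltW.
  by rewrite normrZ -mulrA ler_pM2l// mulrC ler_wpM2r// lerDl.
have key (h : R) : `|h| < d -> dilate (`|h| * (C * E * `|h| )) (disk_set T)
    (f (x + h *: delta_mx 0 i) - f x - h%:C *: partial rc i f x).
  move=> hd'; have [->|h0] := eqVneq h 0.
    by rewrite scale0r addr0 subrr sub0r scale0r oppr0 normr0 mul0r; exists 0; [exact: disk0|rewrite scaler0].
  have h0' : 0 < `|h| by rewrite normr_gt0.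
  apply: (closed_disk_approx clT) => // [|U U0 aU]; first by rewrite mulr_gt0.
  pose D := [set a + u | a in dilate (C * E * `|h|) (disk_set T) & u in U].
  have aD : absconvex D by apply: absconvex_add => //; exact: absconvex_dilate.
  pose g t := f (x + t *: delta_mx 0 i) - t%:C *: partial rc i f x.
  have [|t th|q Dq] := @mean_value_segment _ _ g h D.
  - by case: aD.
  - have [Ot bt] := hd t (le_lt_trans th hd').
    exists (partial rc i f (x + t *: delta_mx 0 i) - partial rc i f x).
      apply: filterS (nbhs_absconvex_translate _ U0) => y Uy.
      exists (partial rc i f (x + t *: delta_mx 0 i) - partial rc i f x).
        by apply: dilate_le bt => //; [rewrite mulr_ge0// ltW|rewrite ler_pM2l].
      by eexists; first exact: Uy; rewrite addrC subrK.
    have -> : (fun h0 : R => (h0^-1)%:C *: (g (t + h0) - g t)) =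
       diff_quot rc i (fun y => f y) (x + t *: delta_mx 0 i) \+ (fun s : R => - ((s^-1 * s)%:C *: partial rc i f x)).
      apply/funext => s; rewrite /g /diff_quot/= scalerDl addrA -addrA opprB.
      rewrite rmorphM/= -scalerA -scalerBr; congr (_ *: _).
      rewrite rmorphD scalerDl opprD -!addrA; congr (_ + _).
      by rewrite [- (s%:C *: _) + _]addrC !addrA addNr add0r addrC.
    apply: tvs_cvgD; first exact: smooth_on_is_partial sf Ot.
    apply: tvs_cvgN; rewrite -[X in _ --> X]scale1r.
    apply: (tvs_cvgZr (s := fun s : R => (s^-1 * s)%:C : R[i]^o)).
    (* [s^-1 * s] equals 1 only for nonzero [s], which the punctured neighbourhood filter grants. *)
    apply: near_cvg (cvg_cst _); near=> s.
    by rewrite mulVf//; near: s; exact: nbhs_dnbhs_neq.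
  rewrite /g !scale0r addr0 subr0 => gh.
  (* The circled set [D] absorbs the sign of [h]. *)
  exists ((h / `|h|)%:C *: q).
    case: aD => _ + _; apply => //; rewrite normc_real normrM normfV normr_id.
    by rewrite divff ?gt_eqF.
  rewrite scalerA -rmorphM/= mulrC divfK ?gt_eqF// -gh.
  by rewrite addrAC.
apply/cvgrPdist_lt => e /gtc0_real[r r0 ->].
near=> h.
have h0 : h != 0 by near: h; exact: nbhs_dnbhs_neq.
have hd' : `|h| < d by near: h; exact: dnbhs0_lt.
have hr : C * E * `|h| < r.
  by rewrite mulrC -ltr_pdivlMr//; near: h; apply: dnbhs0_lt; rewrite divr_gt0.
have [Oh _] := hd h hd'.
rewrite distrC; apply: le_lt_trans (disk_norm_le (r := C * E * `|h|) _ _) _.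
- by rewrite mulr_ge0// ltW.
- rewrite /diff_quot disk_valB disk_valZ disk_valB !disk_liftK; last 3 first.
  + exact: locally_disk_bounded_span bfi Ox.
  + exact: locally_disk_bounded_span bf Ox.
  + exact: locally_disk_bounded_span bf Oh.
  have -> : rc h^-1 *: (f (x + h *: delta_mx 0 i) - f x) - partial rc i f x =
     (h^-1)%:C *: (f (x + h *: delta_mx 0 i) - f x - h%:C *: partial rc i f x).
    by rewrite [RHS]scalerBr scalerA -rmorphM/= mulVf// scale1r.
  have [z Tz <-] := key h hd'; exists ((h^-1 * `|h|)%:C *: z).
    apply: disk_circled => //; rewrite normc_real normrM normfV normr_id.
    by rewrite mulVf ?normr_eq0.
  by rewrite !scalerA -!rmorphM/=; congr (_%:C *: _); ring.
- by rewrite ltcR.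
Unshelve. all: by end_near. Qed.

Let hT : hausdorff_space (disk_space T). Proof. exact: norm_hausdorff. Qed.

Lemma smooth_on_disk_lift f : smooth_on rc O f -> locally_disk_bounded O f ->
  smooth_on rc O (disk_lift f).
Proof.
move=> sf bf; apply/smooth_on_Ck => k; elim: k f sf bf => [|k IH] f sf bf.
  by split=> // x; exact: disk_lift_continuous.
apply: (CkSI (df := fun i => disk_lift (partial rc i f)) hT oO).
- by move=> x; exact: disk_lift_continuous.
- by move=> i x; exact: disk_lift_is_partial.
- move=> i; apply: IH; first exact: (smooth_on_partials [:: i] sf).
  exact: (locally_disk_bounded_partials [:: i] bf).
Qed.

Lemma partials_disk_lift f s x : smooth_on rc O f -> locally_disk_bounded O f -> O x ->
  partials rc s (disk_lift f) x = disk_lift (partials rc s f) x.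
Proof.
move=> sf bf; elim: s x => [//|i s IH] x Ox /=.
have -> : partial rc i (partials rc s (disk_lift f)) x =
    partial rc i (disk_lift (partials rc s f)) x.
  by apply: partial_near; apply: filterS (near_O Ox) => y /IH.
apply: (partialE hT); apply: disk_lift_is_partial => //.
  exact: smooth_on_partials.
exact: locally_disk_bounded_partials.
Qed.

End SmoothLift.

End LiftSmooth.

(** * Bump functions *)

Section FlatFunction.
Context {R : realType}.

(* The derivatives of [t |-> exp (- 1 / t)] on t > 0 are linear combinations of these
   functions. *)
Definition flat (m : nat) (t : R) : R := if 0 < t then t^-1 ^+ m * expR (- t^-1) else 0.

Lemma flat_le0 m t : t <= 0 -> flat m t = 0.
Proof. by rewrite /flat leNgt => /negbTE ->. Qed.

Lemma flat_ge0 m t : 0 <= flat m t.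
Proof.
by rewrite /flat; case: ifP => // t0; rewrite mulr_ge0 ?expR_ge0// exprn_ge0// invr_ge0 ltW.
Qed.

Lemma flat0_gt0 t : 0 < t -> 0 < flat 0 t.
Proof. by rewrite /flat => ->; rewrite expr0 mul1r expR_gt0. Qed.

Lemma flat0_le s t : s <= t -> flat 0 s <= flat 0 t.
Proof.
move=> st; have [s0|s0] := leP s 0; first by rewrite flat_le0// flat_ge0.
have t0 := lt_le_trans s0 st.
by rewrite /flat s0 t0 !expr0 !mul1r ler_expR lerN2 lef_pV2.
Qed.

Lemma flatSE m t : t != 0 -> t^-1 * flat m t = flat m.+1 t.
Proof. by rewrite /flat; case: ifP => t0 _; rewrite ?mulr0// mulrA exprS. Qed.

(** With [y = 1/t], [exp y] is the [m.+1]-st power of [exp (y / m.+1)], which is at least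
    [y / m.+1]. The linear bound makes [flat m] differentiable at 0. *)
Lemma flat_bound m : exists2 C : R, 0 < C & forall t, `|flat m t| <= C * `|t|.
Proof.
exists (m.+1%:R ^+ m.+1); first by rewrite exprn_gt0.
move=> t; have [t0|t0] := leP t 0; first by rewrite flat_le0// normr0 mulr_ge0// exprn_ge0.
rewrite !ger0_norm ?flat_ge0 ?(ltW t0)// /flat t0; set y := t^-1.
have y0 : 0 < y by rewrite invr_gt0.
rewrite expRN ler_pdivrMr ?expR_gt0// -[t]invrK -/y mulrAC ler_pdivlMr//.
rewrite -exprSr.
have e1 : y / m.+1%:R <= expR (y / m.+1%:R).
  by apply: le_trans (expR_ge1Dx _); rewrite lerDr.
have -> : expR y = expR (y / m.+1%:R) ^+ m.+1 by rewrite -expRM_natl mulrC divfK.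
rewrite -exprMn lerXn2r ?nnegrE ?mulr_ge0 ?expR_ge0 ?(ltW y0)//.
by rewrite -ler_pdivrMl// mulrC.
Qed.

Lemma is_derive_flat m (t : R) :
  (fun h : R => h^-1 * (flat m (t + h) - flat m t)) @ 0^' --> flat m.+2 t - m%:R * flat m.+1 t.
Proof.
have [t0|t0|->] := ltgtP t 0.
- rewrite !flat_le0 ?(ltW t0)// mulr0 subr0.
  apply: near_cvg (cvg_cst 0); near=> h.
  rewrite flat_le0 ?subr0 ?mulr0//.
  have : `|h| < - t by near: h; apply: dnbhs0_lt; rewrite oppr_gt0.
  by move=> ht; have := ler_norm h; lra.
- pose f := (fun x : R => x^-1 ^+ m * expR (- x^-1)).
  have d1 : is_derive t (1 : R) (fun x : R => x^-1) (- t ^- 2).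
    have := @is_deriveV R id t 1 1 (lt0r_neq0 t0) (is_derive_id t (1 : R)).
    by rewrite [_ *: _](mulr1 _).
  have d2 : is_derive t (1 : R) (fun x : R => x^-1 ^+ m) (m%:R * t^-1 ^+ m.-1 * - t ^- 2).
    have := is_deriveX m d1; congr is_derive.
    by apply/funext => x; rewrite exprfctE.
  have d3 : is_derive t (1 : R) (fun x : R => expR (- x^-1)) (expR (- t^-1) * t ^- 2).
    have d4 : is_derive t (1 : R) (fun x : R => - x^-1) (t ^- 2).
      by have := is_deriveN d1; rewrite opprK.
    exact: (@is_derive1_comp _ expR (fun x : R => - x^-1) t _ _ (is_derive_expR _) d4).
  have := is_deriveM d2 d3 => -[dfex dfE].
  have df : (fun h : R => h^-1 *: ((f \o shift t) (h *: 1) - f t)) @ 0^' -->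
      flat m.+2 t - m%:R * flat m.+1 t.
    suff <- : derive f t 1 = flat m.+2 t - m%:R * flat m.+1 t by exact: dfex.
    rewrite [LHS]dfE /flat t0 /GRing.scale/= -!exprVn.
    by case: (m) => [|k]; rewrite /= !exprS; ring.
  apply: near_cvg df; near=> h.
  have th : 0 < t + h.
    have : `|h| < t by near: h; exact: dnbhs0_lt.
    by move=> ht; have := ler_norm (- h); rewrite normrN; lra.
  by rewrite /flat t0 th /f/= [h%:A](mulr1 h) (addrC h t).
(* At 0 the difference quotient of [flat m] is [flat m.+1], which the linear bound sends to 0. *)
- rewrite !flat_le0// mulr0 subr0.
  have [C C0 hC] := flat_bound m.+1.
  apply/cvgrPdist_lt => e e0; near=> h.
  have h0 : h != 0 by near: h; exact: nbhs_dnbhs_neq.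
  rewrite sub0r normrN add0r subr0 flatSE//.
  apply: le_lt_trans (hC h) _; rewrite mulrC -ltr_pdivlMr//.
  by near: h; apply: dnbhs0_lt; rewrite divr_gt0.
Unshelve. all: by end_near. Qed.

End FlatFunction.

(** A slope function with limit [d] at [t0] avoids dividing by an inner increment, which may vanish
    in the chain rule. *)
Lemma caratheodory {R : realType} (g : R -> R) (t0 d : R) :
  (fun h : R => h^-1 * (g (t0 + h) - g t0)) @ 0^' --> d ->
  exists2 k : R -> R, k @ t0 --> d & forall t, g t - g t0 = (t - t0) * k t.
Proof.
move=> gd; exists (fun t => if t == t0 then d else (t - t0)^-1 * (g t - g t0)).
  apply/cvgrPdist_lt => e e0.
  have /cvgrPdist_lt/(_ e e0) := gd; rewrite near_withinE.
  move=> /nbhs_ballP[r r0 hr]; apply/nbhs_ballP; exists r => // t tr /=.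
  have [_|tt0] := eqVneq t t0; first by rewrite subrr normr0.
  have := hr (t - t0); rewrite /ball/= sub0r normrN distrC => /(_ tr).
  by rewrite subr_eq0 => /(_ tt0); rewrite (addrC t0) subrK.
move=> t; have [->|tt0] := eqVneq t t0; first by rewrite !subrr mul0r.
by rewrite mulrA divff ?mul1r// subr_eq0.
Qed.

Lemma flat_continuous {R : realType} m : continuous (flat m : R -> R).
Proof.
move=> t0; have [k kd kE] := caratheodory (@is_derive_flat R m t0).
have -> : flat m = fun t => flat m t0 + (t - t0) * k t.
  by apply/funext => t; rewrite -kE addrC subrK.
rewrite /prop_for /continuous_at subrr mul0r.
rewrite -[X in _ + X](mul0r (flat m.+2 t0 - m%:R * flat m.+1 t0)) -[X in X * _](subrr t0).
apply: cvgD; first exact: cvg_cst.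
by apply: cvgM => //; apply: cvgB; [exact: cvg_id|exact: cvg_cst].
Qed.

Section FlatComposition.
Context {R : realType} {n : nat}.
Notation rid := (idfun : {rmorphism R -> R}).
Notation Ckr := (Ck rid (W := R^o)).

Let hR : hausdorff_space R^o. Proof. exact: norm_hausdorff. Qed.

Lemma is_partial_comp1 (g : R -> R) (u : 'rV[R]_n -> R^o) i x (d l : R) :
  (fun h : R => h^-1 * (g (u x + h) - g (u x))) @ 0^' --> d ->
  {for x, continuous u} -> is_partial rid i u x (l : R^o) ->
  is_partial rid i (g \o u : _ -> R^o) x (d * l : R^o).
Proof.
move=> /caratheodory[k kd kE] cu ul.
have cku : (k \o u) @ x --> (d : R^o) by exact: (cvg_comp _ _ cu kd).
rewrite /is_partial (_ : diff_quot _ _ _ _ = fun h =>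
    (k (u (x + h *: delta_mx 0 i)) : R) *: diff_quot rid i u x h).
  apply: (tvs_cvgZ (s := fun h => k (u (x + h *: delta_mx 0 i)) : R^o)) => //.
  exact: (cvg_comp _ _ (@line_cvg _ _ x i) cku).
have mulE (a b c : R) : a * (b * c) = c * (a * b) by ring.
by apply/funext => h; rewrite /diff_quot /= [g _ - _]kE; exact: mulE.
Qed.

(** The induction runs over all [m] together, as the derivative of [flat m] involves [flat m.+1] and
    [flat m.+2]. *)
Lemma Ck_flat k (O : set 'rV[R]_n) u m : open O -> Ckr k O u -> Ckr k O (fun y => flat m (u y)).
Proof.
move=> oO; elim: k u m => [|k IH] u m Cu.
  split=> // x Ox; apply: continuous_comp; first exact: Ck_continuous Cu Ox.
  exact: flat_continuous.
apply: (CkSI (df := fun i y => ((flat m.+2 (u y) + (- m%:R : R) *: (flat m.+1 (u y) : R^o)) : R)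
   *: partial rid i u y)) => //.
- move=> x Ox; apply: continuous_comp; first exact: Ck_continuous Cu Ox.
  exact: flat_continuous.
- move=> i x Ox; apply: is_partial_comp1.
  + by rewrite [X in _ + X]mulNr; exact: is_derive_flat.
  + exact: Ck_continuous Cu Ox.
  + exact: Ck_is_partial hR Cu Ox.
- move=> i; have Cu' := CkS Cu; have [_ /(_ i)[_ Cdu]] := Cu.
  apply: (CkZ hR oO (a := fun y => flat m.+2 (u y) + (- m%:R : R) *: (flat m.+1 (u y) : R^o) : R^o)) => //.
  apply: CkD => //; first exact: IH.
  apply: (CkZ hR oO (a := fun=> - m%:R : R^o)); last exact: IH.
  exact: Ck_cst.
Qed.

End FlatComposition.

Section Plateau.
Context {R : realType}.

(** A smooth step from 0 to 1. The inner difference is nonpositive for [t <= 0] and constant for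
    [t >= 1]; the outer [flat 0] cuts off its nonpositive part. In contrast to the usual quotient of
    two flat functions, the denominator is constant, so closure under composition with [flat] is
    enough. *)
Definition plateau (t : R) : R := flat 0 (flat 0 1 - flat 0 (1 - t)) / flat 0 (flat 0 1).

Lemma plateau_le0 t : t <= 0 -> plateau t = 0.
Proof.
move=> t0; rewrite /plateau flat_le0 ?mul0r// subr_le0; apply: flat0_le.
by rewrite lerBrDl gerDr.
Qed.

Lemma plateau_ge1 t : 1 <= t -> plateau t = 1.
Proof.
move=> t1; rewrite /plateau [flat 0 (1 - t)]flat_le0 ?subr_le0// subr0.
by rewrite divff// gt_eqF// !flat0_gt0.
Qed.

Lemma Ck_plateau k n (O : set 'rV[R]_n) (u : 'rV[R]_n -> R^o) : open O ->
  Ck (idfun : {rmorphism R -> R}) k O u ->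
  Ck (idfun : {rmorphism R -> R}) (W := R^o) k O (fun y => plateau (u y)).
Proof.
move=> oO Cu; have hR : hausdorff_space R^o by exact: norm_hausdorff.
have CN (v : 'rV[R]_n -> R^o) : Ck (idfun : {rmorphism R -> R}) k O v ->
    Ck (idfun : {rmorphism R -> R}) (W := R^o) k O (fun y => - v y).
  move=> Cv; apply: (Ck_eq (f := fun y => (-1 : R) *: v y) oO); first by move=> y _; rewrite scaleN1r.
  by apply: (CkZ hR oO (a := fun=> -1 : R^o) _ Cv); exact: Ck_cst.
apply: (Ck_eq (f := fun y => (flat 0 (flat 0 1 + - flat 0 (1 + - u y)) : R) *:
  ((flat 0 (flat 0 1))^-1 : R^o)) oO) => //.
apply: (CkZ hR oO (a := fun y => flat 0 (flat 0 1 + - flat 0 (1 + - u y)) : R^o)); last exact: Ck_cst.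
apply: (Ck_flat (u := fun y => flat 0 1 + - flat 0 (1 + - u y) : R^o) 0 oO).
apply: CkD => //; first exact: Ck_cst.
apply: (CN _); apply: (Ck_flat (u := fun y => 1 + - u y : R^o) 0 oO).
by apply: CkD => //; [exact: Ck_cst|exact: CN].
Qed.

End Plateau.

(** * Charts, and bump functions on the group *)

Section Charts.
Context {R : realType} {n : nat} {X : topologicalType} (c : chart R n X).

Lemma chart_imgK y : chart_img c y -> chart_dom c (chart_inv c y) /\ chart_fun c (chart_inv c y) = y.
Proof. by case=> x cx <-; rewrite chart_funK. Qed.

Lemma chart_img_fun x : chart_dom c x -> chart_img c (chart_fun c x).
Proof. by move=> cx; exists x. Qed.

Lemma near_chart_dom x : chart_dom c x -> \forall z \near x, chart_dom c z.
Proof. by move=> cx; apply: open_nbhs_nbhs; split=> //; exact: chart_dom_open. Qed.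

Lemma near_chart_img y : chart_img c y -> \forall z \near y, chart_img c z.
Proof. by move=> cy; apply: open_nbhs_nbhs; split=> //; exact: chart_img_open. Qed.

Lemma near_chart_inv y (A : set X) : chart_img c y -> nbhs (chart_inv c y) A ->
  \forall z \near y, A (chart_inv c z).
Proof. by move=> cy Ay; exact: (chart_inv_continuous cy Ay). Qed.

Lemma near_chart_fun x (A : set 'rV[R]_n) : chart_dom c x -> nbhs (chart_fun c x) A ->
  \forall z \near x, A (chart_fun c z).
Proof. by move=> cx Ax; exact: (chart_fun_continuous cx Ax). Qed.

Lemma open_chart_preimage (A : set X) : open A -> open (chart_img c `&` chart_inv c @^-1` A).
Proof.
move=> oA; rewrite openE => y [cy Ay]; apply: filterI; first exact: near_chart_img.
by apply: near_chart_inv => //; exact: open_nbhs_nbhs.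
Qed.

End Charts.

Section Bump.
Context {R : realType} {n : nat} (G : lieGroupType R n).
Notation rc := (real_complex R).
Notation rid := (idfun : {rmorphism R -> R}).

Definition transition (c d : chart R n G) := chart_fun c \o chart_inv d.
Definition overlap (c d : chart R n G) := chart_img d `&` chart_inv d @^-1` chart_dom c.

Lemma open_overlap c d : open (overlap c d).
Proof. by apply: open_chart_preimage; exact: chart_dom_open. Qed.

Lemma transition_smooth (c d : chart R n G) : atlas c -> atlas d ->
  smooth_on idfun (overlap c d) (transition c d).
Proof. by move=> ac ad; exact: atlas_smooth. Qed.

Lemma transition_img c d y : overlap c d y -> chart_img c (transition c d y).
Proof. by case=> _ /chart_img_fun. Qed.

Lemma exists_bump (c : chart R n G) x0 : atlas c -> chart_dom c x0 ->
  exists (h : G -> R[i]^o) (K : set G),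
    [/\ smooth h, compact K, K `<=` chart_dom c, forall x, ~ K x -> h x = 0 &
        \forall x \near x0, h x = 1].
Proof.
move=> ac cx0; set z := chart_fun c x0.
have [e e0 ze] : exists2 e : R, 0 < e & ball z e `<=` chart_img c.
  by have /nbhs_ballP[e e0 ?] := near_chart_img (chart_img_fun cx0); exists e.
pose B := [set y : 'rV[R]_n | `|z - y| <= e / 2].
have Bimg : B `<=` chart_img c.
  move=> y By; apply: ze; rewrite -ball_normE/=; apply: le_lt_trans By _.
  by rewrite ltr_pdivrMr// ltr_pMr// ltr1n.
have Bco : compact B.
  apply: bounded_closed_compact; last exact: closed_closed_ball_.
  exists (`|z| + e / 2); split; first by rewrite num_real.
  move=> M hM y By; apply: le_trans (ltW hM).
  rewrite -[y](subKr z); apply: le_trans (ler_normB _ _) _.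
  by rewrite lerD2l.
pose K := chart_inv c @` B.
have Kdom : K `<=` chart_dom c by move=> _ [y /Bimg/chart_imgK[? _] <-].
have Kco : compact K.
  apply: continuous_compact => //; apply: continuous_in_subspaceT => y.
  by rewrite inE => /Bimg cy; exact: chart_inv_continuous.
have Kcl : closed K by apply: compact_closed => //; exact: lie_hausdorff.
(* The sum of squares is smooth, unlike the supremum norm. Since [8 / e^2] times [(e / 2)^2] is 2,
   positivity of [u] forces every entry of [y - z] below [e / 2] in modulus, hence [y] in [B]; and
   [u z = 2 > 1] puts the plateau at height 1 near [z]. *)
pose u (y : 'rV[R]_n) : R^o := 2 + \sum_k (- (8 / e ^+ 2) : R) *:
  ((y ord0 k - z ord0 k : R) *: (y ord0 k - z ord0 k : R^o)).
have uz : u z = 2.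
  rewrite /u big1 ?addr0// => k _.
  by rewrite subrr scaler0 scaler0.
have uB y : 0 < u y -> B y.
  rewrite /u -scaler_sumr => uy; rewrite /B/= [leLHS](_ : _ = mx_norm (z - y))// mx_normrE.
  apply/bigmax_leP; split=> [|[i k] _ /=]; first by rewrite divr_ge0// ltW.
  rewrite ord1 !mxE distrC.
  have : (y ord0 k - z ord0 k) ^+ 2 <= (e / 2) ^+ 2.
    have h1 : (y ord0 k - z ord0 k) ^+ 2 <= \sum_k (y ord0 k - z ord0 k) ^+ 2.
      by rewrite (bigD1 k)//= lerDl sumr_ge0// => k' _; rewrite sqr_ge0.
    apply: le_trans h1 _; move: uy; under eq_bigr => k' _ do rewrite -[_ *: _]expr2.
    rewrite [_ *: _]mulNr subr_gt0 mulrAC ltr_pdivrMr ?exprn_gt0// => /ltW.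
    rewrite expr_div_n ler_pdivlMr ?exprn_gt0//.
    set S := \sum_k _; move: (e ^+ 2) S => a S; lra.
  by rewrite -[X in X <= _]real_normK ?num_real// ler_sqr// nnegrE divr_ge0// ltW.
have Cu k (O : set 'rV[R]_n) (phi : 'rV[R]_n -> 'rV[R]_n) : open O ->
    smooth_on idfun O phi -> Ck rid k O (u \o phi).
  move=> oO sphi; have hR : hausdorff_space R^o by exact: norm_hausdorff.
  have sco m : Ck rid (W := R^o) k O (fun y => phi y ord0 m - z ord0 m).
    apply: CkD => //; last exact: Ck_cst.
    apply: (iffLR (smooth_on_Ck _ _ _) _ k).
    apply: (@smooth_on_linear R R R rid rid 'rV[R]_n R^o n _ _ (fun v => v ord0 m)).
    - exact: norm_hausdorff.
    - exact: norm_hausdorff.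
    - by move=> v w; rewrite !mxE.
    - by move=> r v; rewrite !mxE.
    - exact: coord_continuous.
    - exact: oO.
    - exact: sphi.
  apply: CkD => //; first exact: Ck_cst.
  apply: (Ck_sum _ (F := fun m y => (- (8 / e ^+ 2) : R) *:
    ((phi y ord0 m - z ord0 m : R) *: (phi y ord0 m - z ord0 m : R^o)))) => // m.
  apply: (CkZ hR oO (a := fun=> - (8 / e ^+ 2) : R^o)); first exact: Ck_cst.
  exact: (CkZ hR oO (a := fun y => phi y ord0 m - z ord0 m : R^o)).
pose h x : R[i]^o := if `[< chart_dom c x >] then (plateau (u (chart_fun c x)))%:C else 0.
have hK x : ~ K x -> h x = 0.
  move=> Kx; rewrite /h; case: asboolP => // cx.
  rewrite plateau_le0// leNgt; apply/negP => /uB Bx; apply: Kx.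
  by exists (chart_fun c x); rewrite // chart_funK.
exists h, K; split => //; last first.
  have zO : overlap c c z by split; [exact: chart_img_fun|rewrite /= /z chart_funK].
  have uc : {for z, continuous u}.
    apply: (continuous_near (f := u \o transition c c)).
      apply: filterS (near_chart_img (chart_img_fun cx0)) => y /chart_imgK[_ cy].
      by rewrite /transition/= cy.
    exact: Ck_continuous (Cu 0%N _ _ (@open_overlap c c) (transition_smooth ac ac)) zO.
  have /(near_chart_fun cx0) : \forall y \near z, 1 < u y.
    have U1 : nbhs (u z) [set t : R | 1 < t].
      by rewrite uz; apply: open_nbhs_nbhs; split; [exact: open_gt|rewrite /= ltr1n].
    exact: (uc _ U1).
  move=> un; apply: filterS2 un (near_chart_dom cx0) => x ux cx.
  by rewrite /h; case: asboolP => // _; rewrite plateau_ge1// ltW.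
move=> d ad s y dy; have [cdy|cdy] := pselect (chart_dom c (chart_inv d y)).
  have oO : open (overlap c d) by exact: open_overlap.
  apply: (@smooth_on_near _ _ rc _ _ (overlap c d)
    ((real_complex R : R^o -> R[i]^o) \o (fun y => plateau (u (transition c d y)) : R^o))); last by [].
    move=> w ow; apply: filterS (open_nbhs_nbhs (conj oO ow)) => w' [_ cw'] /=.
    by rewrite /h/=; case: asboolP.
  apply: (@smooth_on_linear R R R[i] rid rc R^o R[i]^o).
  - exact: norm_hausdorff.
  - exact: norm_hausdorff.
  - by move=> v w; rewrite rmorphB.
  - by move=> r v; rewrite /GRing.scale/= rmorphM.
  - exact: real_complex_continuous.
  - exact: oO.
  - apply/smooth_on_Ck => k; apply: (Ck_plateau (u := u \o transition c d) oO).
    exact: Cu oO (transition_smooth ac ad).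
(* Outside the domain of [c] the point lies off [K], which is closed as a compact subset of a
   Hausdorff space, so [h] vanishes nearby. *)
apply: (@smooth_on_near _ _ rc _ _ [set y] (fun=> 0)); last by [].
  move=> _ ->; have Ky : ~ K (chart_inv d y) by move=> /Kdom.
  have : \forall x \near chart_inv d y, ~ K x.
    by apply: open_nbhs_nbhs; split=> //; exact: closed_openC.
  by move=> /(near_chart_inv dy); apply: filterS => w /hK.
apply: (@smooth_on_subset _ _ _ _ _ setT) => //.
by apply/smooth_on_Ck => k; apply: Ck_cst; [exact: norm_hausdorff|exact: openT].
Qed.

End Bump.

(** * The von Neumann and precompact bornologies *)

Section DiskHull.
Context {R : realType} {V : tvsType R[i]}.
Implicit Types S C D : set V.

(* The closure of the absolutely convex hull. *)
Definition disk_hull S : set V := [set x | forall C D, absconvex C -> S `<=` C ->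
  absconvex D -> nbhs (0 : V) D -> exists2 c, C c & D (x - c)].

Lemma subset_disk_hull S : S `<=` disk_hull S.
Proof.
move=> x Sx C D _ SC aD _; exists x; first exact: SC.
by rewrite subrr; case: aD.
Qed.

Lemma absconvex_disk_hull S : absconvex (disk_hull S).
Proof.
split.
- move=> C D aC _ aD _; exists 0; first by case: aC.
  by rewrite subrr; case: aD.
- move=> a x a1 hx C D aC SC aD D0; have [c Cc Dxc] := hx C D aC SC aD D0.
  exists (a *: c); first by case: aC => _ + _; apply.
  by rewrite -scalerBr; case: aD => _ + _; apply.
- apply: convex_setI => a b x y a0 b0 ab1 hx hy C D aC SC aD D0.
  have [c Cc Dc] := hx C D aC SC aD D0; have [d Cd Dd] := hy C D aC SC aD D0.
  exists (a%:C *: c + b%:C *: d); first by apply: convex_comb1 => //; case: aC.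
  rewrite opprD addrACA -!scalerBr.
  by apply: convex_comb1 => //; case: aD.
Qed.

Lemma closed_disk_hull S : closed (disk_hull S).
Proof.
move=> x clx C D aC SC aD D0.
have [E [E0 aE ED EED]] := nbhs_absconvex_half D0.
have [y [hy Ey]] := clx _ (nbhs_absconvex_translate x E0).
have [c Cc Eyc] := hy C E aC SC aE E0; exists c => //.
rewrite -[x](subrK y) -addrA; apply: EED => //.
by rewrite -opprB; exact: absconvexN.
Qed.

Lemma disk_hull_subset S C D : absconvex C -> S `<=` C -> absconvex D -> nbhs (0 : V) D ->
  disk_hull S `<=` [set c + d | c in C & d in D].
Proof.
move=> aC SC aD D0 x hx; have [c Cc Dxc] := hx C D aC SC aD D0.
by exists c => //; exists (x - c); rewrite // addrC subrK.
Qed.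

End DiskHull.

Section EventuallyIn.
Context {T : Type}.

(** The filter of enlarging a member of [B]. The near-covering form of compactness over this filter
    replaces extracting a finite subcover and uniting the bounded sets attached to its members. *)
Definition eventually_in (B : set_system T) : set_system (set T) :=
  [set P | exists2 S0, B S0 & forall S, B S -> S0 `<=` S -> P S].

Lemma eventually_in_filter (B : set_system T) S0 : B S0 ->
  (forall S S', B S -> B S' -> B (S `|` S')) -> Filter (eventually_in B).
Proof.
move=> B0 BU; split; first by exists S0.
- move=> P Q [S BS hS] [S' BS' hS']; exists (S `|` S'); first exact: BU.
  by move=> U BU'; rewrite subUset => -[SU S'U]; split; [exact: hS|exact: hS'].
- by move=> P Q PQ [S BS hS]; exists S => // U BU' SU; apply: PQ; exact: hS.
Qed.

End EventuallyIn.

Section Bornologies.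
Context {R : realType} {V : tvsType R[i]}.
Implicit Types S U D : set V.

(** [adm_approx] serves the metrizability argument, where a union of sets shrinking to 0 is a finite
    union up to any given neighbourhood. [adm_image] turns equicontinuity of differential operators
    over a compact set into boundedness of derivatives. *)
Record admissible (B : set_system V) : Prop := {
  adm_von_neumann : forall S, B S -> von_neumann S;
  adm_subset : forall S S', S `<=` S' -> B S' -> B S;
  adm_setU : forall S S', B S -> B S' -> B (S `|` S');
  adm_set1 : forall v, B [set v];
  adm_dilate : forall r S, 0 < r -> B S -> B (dilate r S);
  adm_approx : forall S, (forall D, nbhs (0 : V) D -> absconvex D ->
    exists2 S', B S' & S `<=` [set a + u | a in S' & u in D]) -> B S;
  adm_hull : forall S, B S -> B (disk_hull S);
  adm_null : forall s : nat -> V, s @ \oo --> (0 : V) -> B (range s);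
  adm_image : forall (X : topologicalType) (L : set X) (F : V -> X -> V) S,
    compact L -> (forall x a u v, F (a *: u + v) x = a *: F u x + F v x) ->
    (forall v, {within L, continuous (F v)}) ->
    (forall U, nbhs (0 : V) U -> \forall w \near (0 : V), forall x, L x -> U (F w x)) ->
    B S -> B [set F v x | v in S & x in L] }.

Lemma absorbs_dilate D S : absconvex D -> absorbs D S <-> exists2 r : R, 0 < r & S `<=` dilate r D.
Proof.
move=> aD; split=> [[r r0 h]|[r r0 SD]].
  by exists r => //; apply: h; rewrite normc_real gtr0_norm.
exists r => // a ra x /SD[z Dz <-]; have a0 : a != 0.
  by rewrite -normr_gt0; apply: lt_le_trans ra; rewrite ltcR.
exists ((r%:C / a) *: z); last by rewrite scalerA mulrC divfK.
case: aD => _ + _; apply => //; rewrite normrM normfV normc_real gtr0_norm//.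
by rewrite ler_pdivrMr ?mul1r// normr_gt0.
Qed.

Lemma von_neumannP S : von_neumann S <->
  forall D, nbhs (0 : V) D -> absconvex D -> exists2 r : R, 0 < r & S `<=` dilate r D.
Proof.
split=> [h D D0 aD|h U /nbhs_absconvex[D [D0 aD DU]]].
  by apply/absorbs_dilate => //; exact: h.
have /(absorbs_dilate _ aD)[r r0 hr] := h D D0 aD.
by exists r => // a /hr Sa x /Sa[u /DU Uu <-]; exists u.
Qed.

Lemma von_neumann_set1 v : von_neumann [set v : V].
Proof.
apply/von_neumannP => D D0 aD.
have : (fun r : R => r%:C *: v) @ (0 : R) --> (0 : R)%:C *: v.
  by apply: (tvs_cvgZr (s := fun r : R => r%:C : R[i]^o)); exact: real_complex_continuous.
rewrite scale0r => /(_ _ D0); rewrite nbhs_filterE/= => /nbhs_ballP[e /= e0 he].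
have e2 : 0 < e / 2 by rewrite divr_gt0.
exists (e / 2)^-1; first by rewrite invr_gt0.
move=> _ ->; exists ((e / 2)%:C *: v).
  apply: he; rewrite /ball/= sub0r normrN gtr0_norm//.
  by rewrite ltr_pdivrMr// ltr_pMr// ltr1n.
by rewrite scalerA -rmorphM/= mulVf ?gt_eqF// scale1r.
Qed.

Lemma von_neumann_setU S S' : von_neumann S -> von_neumann S' -> von_neumann (S `|` S').
Proof.
move=> /von_neumannP hS /von_neumannP hS'; apply/von_neumannP => D D0 aD.
have [r r0 Sr] := hS D D0 aD; have [s s0 Ss] := hS' D D0 aD.
exists (r + s); first by rewrite addr_gt0.
move=> x [/Sr|/Ss]; apply: dilate_le => //; rewrite ?(ltW r0) ?(ltW s0)//.
  by rewrite lerDl ltW.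
by rewrite lerDr ltW.
Qed.

Lemma von_neumann_finite S : finite_set S -> von_neumann S.
Proof.
move=> /finite_seqP[s ->]; elim: s => [|a s IH].
  by apply/von_neumannP => D D0 aD; exists 1.
rewrite (_ : [set` a :: s] = [set a] `|` [set` s]).
  by apply: von_neumann_setU => //; exact: von_neumann_set1.
apply/seteqP; split=> x; rewrite /= inE; first by move=> /orP[/eqP->|]; [left|right].
by move=> [->|->]; rewrite ?eqxx ?orbT.
Qed.

Lemma von_neumann_approx S : (forall D, nbhs (0 : V) D -> absconvex D ->
    exists2 S', von_neumann S' & S `<=` [set a + u | a in S' & u in D]) -> von_neumann S.
Proof.
move=> h; apply/von_neumannP => D D0 aD.
have [S' /von_neumannP/(_ D D0 aD)[r r0 S'r] SS'] := h D D0 aD.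
exists (r + 1); first by rewrite addr_gt0.
move=> x /SS'[a /S'r ra [u Du <-]]; apply: dilateD ra _; rewrite ?(ltW r0)//.
  by case: aD.
by rewrite dilate1.
Qed.

Lemma von_neumann_subset S S' : S `<=` S' -> von_neumann S' -> von_neumann S.
Proof.
move=> SS' /von_neumannP h; apply/von_neumannP => D D0 aD.
by have [r r0 S'r] := h D D0 aD; exists r => // x /SS'/S'r.
Qed.

Lemma precompactP S : precompact_bornology S <->
  forall D, nbhs (0 : V) D -> absconvex D ->
    exists2 A, finite_set A & S `<=` [set a + u | a in A & u in D].
Proof.
split=> [h D D0 _|h U /nbhs_absconvex[D [D0 aD DU]]]; first exact: h.
have [A fA SA] := h D D0 aD; exists A => // x /SA[a Aa [u /DU Uu <-]].
by exists a => //; exists u.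
Qed.

Lemma precompact_von_neumann S : precompact_bornology S -> von_neumann S.
Proof.
move=> /precompactP h; apply: von_neumann_approx => D D0 aD.
by have [A fA SA] := h D D0 aD; exists A => //; exact: von_neumann_finite.
Qed.

Lemma precompact_subset S S' : S `<=` S' -> precompact_bornology S' -> precompact_bornology S.
Proof.
move=> SS' h U U0; have [A fA S'A] := h U U0; exists A => //.
exact: subset_trans S'A.
Qed.

Lemma precompact_finite S : finite_set S -> precompact_bornology S.
Proof.
move=> fS U U0; exists S => // x Sx; exists x => //; exists 0; rewrite ?addr0//.
exact: nbhs_singleton.
Qed.

Lemma precompact_setU S S' : precompact_bornology S -> precompact_bornology S' ->
  precompact_bornology (S `|` S').
Proof.
move=> hS hS' U U0; have [A fA SA] := hS U U0; have [A' fA' SA'] := hS' U U0.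
exists (A `|` A'); first by rewrite finite_setU.
by move=> x [/SA[a Aa [u Uu <-]]|/SA'[a Aa [u Uu <-]]]; exists a;
  [left|exists u|right|exists u].
Qed.

Lemma precompact_approx S : (forall D, nbhs (0 : V) D -> absconvex D ->
    exists2 S', precompact_bornology S' & S `<=` [set a + u | a in S' & u in D]) ->
  precompact_bornology S.
Proof.
move=> h U /nbhs_absconvex_half[D [D0 aD DU DDU]].
have [S' hS' SS'] := h D D0 aD; have [A fA S'A] := hS' D D0.
exists A => // x /SS'[b /S'A[a Aa [u Du <-]] [v Dv <-]].
by exists a => //; exists (u + v); [exact: DDU|rewrite addrA].
Qed.

Lemma precompact_add S S' : precompact_bornology S -> precompact_bornology S' ->
  precompact_bornology [set x + y | x in S & y in S'].
Proof.
move=> hS hS' U /nbhs_absconvex_half[D [D0 aD DU DDU]].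
have [A fA SA] := hS D D0; have [A' fA' SA'] := hS' D D0.
exists [set x + y | x in A & y in A']; first exact: finite_image2.
move=> _ [_ /SA[a Aa [u Du <-]] [_ /SA'[b Ab [v Dv <-]] <-]].
exists (a + b); first by exists a => //; exists b.
by exists (u + v); [exact: DDU|rewrite addrACA].
Qed.

Lemma precompact_compact S : compact S -> precompact_bornology S.
Proof.
move=> /compact_near_coveringP cS; apply/precompactP => D D0 aD.
have FF := @eventually_in_filter V finite_set set0 (finite_set0 V)
  (fun A A' fA fA' => eq_ind_r id (conj fA fA') (finite_setU A A')).
have := cS _ (eventually_in finite_set) (fun A x => exists2 a, A a & D (x - a)) FF.
case.
  move=> x Sx; exists ([set y | D (y - x)], [set A | A x]) => /=.
    split; first exact: nbhs_absconvex_translate.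
    by exists [set x]; [exact: finite_set1|move=> A _; exact].
  by move=> [y A] [/= Dyx Ax]; exists x.
move=> A0 fA0 h; exists A0 => // x Sx; have [a Aa Dxa] := h A0 fA0 (@subset_refl _ A0) x Sx.
by exists a => //; exists (x - a); rewrite // addrC subrK.
Qed.

(** Real and imaginary parts place this set inside the sum of the compact segments spanned by [v]
    and ['i *: v]. *)
Lemma precompact_circle (v : V) : precompact_bornology [set a *: v | a in [set a : R[i] | `|a| <= 1]].
Proof.
have seg (w : V) : precompact_bornology [set r%:C *: w | r in [set r : R | -1 <= r <= 1]].
  apply: precompact_compact; apply: continuous_compact.
    apply: continuous_subspaceT => r.
    by apply: (tvs_cvgZr (s := fun r : R => r%:C : R[i]^o)); exact: real_complex_continuous.
  have -> : [set r : R | -1 <= r <= 1] = `[-1, 1]%classic by apply/seteqP; split=> r /=; rewrite in_itv.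
  exact: segment_compact.
apply: precompact_subset (precompact_add (seg v) (seg ('i *: v))).
move=> _ [a a1 <-].
have aRe : `|complex.Re a| <= 1.
  by rewrite -lecR; apply: le_trans (normc_ge_Re a) _.
have aIm : `|complex.Im a| <= 1.
  rewrite -lecR; apply: le_trans _ a1; rewrite normc_def lecR -sqrtr_sqr.
  by rewrite ler_sqrt ?addr_ge0 ?sqr_ge0// lerDr sqr_ge0.
exists ((complex.Re a)%:C *: v); first by exists (complex.Re a); rewrite //= -ler_norml.
exists ((complex.Im a)%:C *: ('i *: v)); first by exists (complex.Im a); rewrite //= -ler_norml.
rewrite scalerA -scalerDl; congr (_ *: _).
by rewrite [RHS]complexE mulrC.
Qed.

(** The Minkowski sum of the complex discs through the points of [S] is absolutely convex and
    contains [S]. *)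
Lemma precompact_absconvex_finite S : finite_set S ->
  exists Z, [/\ absconvex Z, S `<=` Z & precompact_bornology Z].
Proof.
move=> /finite_seqP[s ->]; elim: s => [|v s [Z [aZ sZ pZ]]].
  exists [set 0]; split=> //; last by apply: precompact_finite.
  split=> // [a _ _ ->|]; first by rewrite scaler0.
  by apply: convex_setI => a b _ _ _ _ _ -> ->; rewrite !scaler0 addr0.
exists [set x + y | x in [set a *: v | a in [set a : R[i] | `|a| <= 1]] & y in Z]; split.
- apply: absconvex_add => //; split.
  + by exists 0; rewrite ?scale0r//= normr0.
  + move=> a _ a1 [b b1 <-]; exists (a * b); last by rewrite scalerA.
    by rewrite /= normrM mulr_ile1.
  + apply: convex_setI => a b _ _ a0 b0 ab1 [c c1 <-] [d d1 <-].
    exists (a%:C * c + b%:C * d); last by rewrite scalerDl !scalerA.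
    rewrite /=; apply: le_trans (ler_normD _ _) _; rewrite !normrM !normc_real (ger0_norm a0) (ger0_norm b0).
    rewrite -[leRHS](_ : a%:C + b%:C = 1); last by rewrite -rmorphD ab1.
    by apply: lerD; apply: ler_piMr => //; rewrite lecR.
- move=> x; rewrite /= inE => /orP[/eqP->|xs].
    exists v; first by exists 1; rewrite ?scale1r//= normr1.
    by exists 0; rewrite ?addr0//; case: aZ.
  exists 0; first by exists 0; rewrite ?scale0r//= normr0.
  by exists x; rewrite ?add0r//; exact: sZ.
- by apply: precompact_add => //; exact: precompact_circle.
Qed.

Lemma precompact_null (s : nat -> V) : s @ \oo --> (0 : V) -> precompact_bornology (range s).
Proof.
move=> s0 U U0; have [N _ NU] := s0 U U0.
exists (s @` `I_N `|` [set 0]).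
  by rewrite finite_setU; split; [exact/finite_image/finite_II|exact: finite_set1].
move=> _ [n _ <-]; have [nN|Nn] := ltnP n N.
  exists (s n); first by left; exists n.
  by exists 0; rewrite ?addr0//; exact: nbhs_singleton.
exists 0; first by right.
by exists (s n); rewrite ?add0r//; exact: NU.
Qed.

Lemma linear_image_dilate (X : Type) (F : V -> X -> V) :
  (forall x a u v, F (a *: u + v) x = a *: F u x + F v x) ->
  forall x a u, F (a *: u) x = a *: F u x.
Proof.
move=> FL x a u; have F0 : F 0 x = 0.
  by have := FL x (-1) 0 0; rewrite scaler0 addr0 scaleN1r addNr.
by have := FL x a u 0; rewrite addr0 F0 addr0.
Qed.

Lemma von_neumann_image (X : Type) (L : set X) (F : V -> X -> V) S :
  (forall x a u v, F (a *: u + v) x = a *: F u x + F v x) ->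
  (forall U, nbhs (0 : V) U -> \forall w \near (0 : V), forall x, L x -> U (F w x)) ->
  von_neumann S -> von_neumann [set F v x | v in S & x in L].
Proof.
move=> FL Fe /von_neumannP hS; apply/von_neumannP => U U0 aU.
have [D [D0 aD DU]] := nbhs_absconvex (Fe U U0).
have [r r0 Sr] := hS D D0 aD; exists r => // _ [_ /Sr[v Dv <-] [x Lx <-]].
exists (F v x); first exact: DU.
by rewrite (linear_image_dilate FL).
Qed.

Lemma von_neumann_admissible : admissible von_neumann.
Proof.
split=> //.
- exact: von_neumann_subset.
- exact: von_neumann_setU.
- exact: von_neumann_set1.
- move=> r S r0 /von_neumannP hS; apply/von_neumannP => D D0 aD.
  have [s s0 Ss] := hS D D0 aD; exists (r * s); first by rewrite mulr_gt0.
  by move=> _ [x /Ss Dx <-]; exact: dilateM.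
- exact: von_neumann_approx.
- move=> S /von_neumannP hS; apply/von_neumannP => D D0 aD.
  have [r r0 Sr] := hS D D0 aD; exists (r + 1); first by rewrite addr_gt0.
  move=> x /(disk_hull_subset (absconvex_dilate r aD) Sr aD D0)[y ry [d Dd <-]].
  apply: dilateD ry _ => //; rewrite ?(ltW r0)//; first by case: aD.
  by rewrite dilate1.
- by move=> s /precompact_null/precompact_von_neumann.
- by move=> X L F S _ FL _; exact: von_neumann_image.
Qed.

Lemma precompact_admissible : admissible precompact_bornology.
Proof.
split.
- exact: precompact_von_neumann.
- exact: precompact_subset.
- exact: precompact_setU.
- by move=> v; apply: precompact_finite.
- move=> r S r0 hS U U0; have rn0 : r%:C != 0 by rewrite fmorph_eq0 gt_eqF.
  have [A fA SA] := hS _ (nbhs0_scale r%:C U0).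
  exists (dilate r A); first exact: finite_image.
  move=> _ [_ /SA[a Aa [u Uu <-]] <-]; exists (r%:C *: a); first by exists a.
  by exists (r%:C *: u); rewrite // scalerDr.
- exact: precompact_approx.
(* If [S] lies in [A + E] with [A] finite, it lies in the absolutely convex [Z + E], and its closed
   hull in [Z + E + E], hence in [Z + D]. *)
- move=> S hS; apply: precompact_approx => D D0 aD.
  have [E [E0 aE ED EED]] := nbhs_absconvex_half D0.
  have [A fA SA] := hS E E0.
  have [Z [aZ AZ pZ]] := precompact_absconvex_finite fA.
  exists Z => //; have SZ : S `<=` [set z + u | z in Z & u in E].
    by move=> x /SA[a /AZ Za [u Eu <-]]; exists a => //; exists u.
  move=> x /(disk_hull_subset (absconvex_add aZ aE) SZ aE E0)[_ [z Zz [u Eu <-]] [v Ev <-]].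
  by exists z => //; exists (u + v); [exact: EED|rewrite addrA].
- exact: precompact_null.
(* Equicontinuity reduces [S] to a finite set [A] up to an error in [D], and each point of [A]
   contributes a continuous image of the compact [L]. *)
- move=> X L F S cL FL Fc Fe hS; apply: precompact_approx => D D0 aD.
  have [A fA SA] := hS _ (Fe D D0).
  exists [set F v x | v in A & x in L]; last first.
    move=> _ [_ /SA[a Aa [w Fw <-]] [x Lx <-]].
    exists (F a x); first by exists a => //; exists x.
    exists (F w x); first exact: Fw.
    by have := FL x 1 a w; rewrite !scale1r.
  move: fA => /finite_seqP[s ->]; elim: s {SA}=> [|a s IH].
    by apply: precompact_subset (precompact_finite (finite_set0 V)) => z [v].
  apply: precompact_subset (precompact_setU (precompact_compact (continuous_compact (Fc a) cL)) IH).
  move=> _ [v + [x Lx <-]]; rewrite /= inE => /orP[/eqP->|vs]; first by left; exists x.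
  by right; exists v => //; exists x.
Qed.

End Bornologies.

(** * Bounded disks in Fréchet spaces *)

Section FrechetSpaces.
Context {R : realType} {V : frechetType R[i]}.
Implicit Types S U D : set V.

Lemma entourage_subP (E : set (V * V)) : entourage E ->
  exists2 A, entourage A & forall x x' y y', A (x, x') -> A (y, y') -> E (x - y, x' - y').
Proof.
move=> /frechet_sub_unif_continuous; rewrite nbhs_filterE/= => -[[A B]/= [eA eB] AB].
exists (A `&` B); first exact: filterI.
move=> x x' y y' [Ax _] [_ By].
by have [[[a b] [c d]]/= h [<- <- <- <-]] := AB ((x, x'), (y, y')) (conj Ax By).
Qed.

(** Subtracting [(-y, -y)] from [(x - y, 0)] gives [(x, y)]. Together with [nbhs0_entourage] this
    identifies the uniformity with the translation-invariant one. *)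
Lemma entourage_nbhs0 (E : set (V * V)) : entourage E ->
  exists2 U, nbhs (0 : V) U & forall x y, U (x - y) -> E (x, y).
Proof.
move=> /entourage_subP[A eA AE]; exists [set d | A (d, 0)].
  apply/nbhsP; exists A^-1%relation; first exact: entourage_inv.
  by move=> d; rewrite /xsection/= inE.
move=> x y Axy; have := AE _ _ (- y) (- y) Axy (entourage_refl _ eA).
by rewrite !opprK subrK add0r.
Qed.

Lemma nbhs0_entourage U : nbhs (0 : V) U ->
  exists2 E, entourage E & forall x y, E (x, y) -> U (x - y).
Proof.
move=> /nbhsP[E eE EU]; have [A eA AE] := entourage_subP (entourage_inv eE).
exists A => // x y Axy; apply: EU; rewrite /xsection/= inE.
by have := AE _ _ y y Axy (entourage_refl _ eA); rewrite subrr.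
Qed.

Lemma frechet_basis : exists2 U : nat -> set V,
  forall m, nbhs (0 : V) (U m) /\ absconvex (U m) &
  (forall l m, (l <= m)%N -> U m `<=` U l) /\
  forall A, nbhs (0 : V) A -> exists m, U m `<=` A.
Proof.
have /countable_uniformityP[f fA ef] := @frechet_metrizable _ V.
have /choice[N NP] : forall m, exists D, [/\ nbhs (0 : V) D, absconvex D &
    forall x, D x -> f m (x, 0)].
  move=> m; have [W /nbhs_absconvex[D [D0 aD DW]] Wf] := entourage_nbhs0 (ef m).
  by exists D; split=> // x /DW Wx; apply: Wf; rewrite subr0.
pose U m := [set x | forall l, (l <= m)%N -> N l x].
exists U => [m|]; last split.
- split.
    have : \forall x \near (0 : V), forall l : 'I_m.+1, N l x.
      by apply: filter_forall => l; case: (NP l).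
    by apply: filterS => x h l lm; exact: (h (Ordinal (lm : (l < m.+1)%N))).
  split.
  + by move=> l _; case: (NP l) => _ [].
  + by move=> a x a1 h l lm; case: (NP l) => _ [_ + _] _; apply=> //; exact: h.
  + apply: convex_setI => a b x y a0 b0 ab1 hx hy l lm.
    by apply: convex_comb1 => //; [case: (NP l) => _ []|exact: hx|exact: hy].
- by move=> l m lm x h k kl; apply: h; exact: leq_trans lm.
- move=> A /nbhs0_entourage[E /fA[m fE] EA]; exists m => x /(_ m (leqnn m)) Nx.
  by rewrite -[x]subr0; apply/EA/fE; case: (NP m) => _ _; exact.
Qed.

Lemma hausdorff_nbhs0 (x : V) : (forall U, nbhs (0 : V) U -> U x) -> x = 0.
Proof.
move=> h; apply: (@frechet_hausdorff _ V) => A B /= Ax B0.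
exists x; split; first exact: nbhs_singleton.
exact: h.
Qed.

Variable B : set_system V.
Hypothesis admB : admissible B.

Lemma bounded_disk_sep S x : von_neumann S -> (forall a : R[i], S (a *: x)) -> x = 0.
Proof.
move=> /von_neumannP bS h; apply: hausdorff_nbhs0 => U /nbhs_absconvex[D [D0 aD DU]].
have [r r0 Sr] := bS D D0 aD.
have [y Dy rx] := Sr _ (h r%:C); apply: DU.
by rewrite (_ : x = y)//; apply: (scalerI (a := r%:C)); rewrite ?fmorph_eq0 ?gt_eqF.
Qed.

(** As [T] is bounded, a Cauchy filter for the gauge is Cauchy in [V] and converges there. As [T] is
    closed, gauge estimates pass to the limit in [V], which is therefore a limit for the gauge
    too. *)
Lemma closed_disk_complete (T : disk V) : B (disk_set T) -> closed (disk_set T) ->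
  bounded_complete_disk B T.
Proof.
move=> BT clT; have /von_neumannP bT := adm_von_neumann admB BT.
have aT := absconvex_disk T.
split=> // [x x1|F FF Fc].
  rewrite -[disk_set T]dilate1 -[1](mul1r 1); apply: closed_disk_approx => // U U0 aU.
  rewrite dilate1.
  have [r r0 Tr] := bT U U0 aU.
  (* A vector of norm at most 1 is [t + r^-1 t] with [t] in [T], and [r^-1 T] lies in [U]. *)
  have lt1 : `|x| < (1 + r^-1)%:C.
    by apply: le_lt_trans x1 _; rewrite ltcR ltrDl invr_gt0.
  have := disk_norm_lt lt1 => -[t Tt <-].
  rewrite rmorphD scalerDl scale1r.
  exists t; first by rewrite dilate1.
  exists ((r^-1)%:C *: t) => //.
  by have [u Uu <-] := Tr t Tt; rewrite scalerA -rmorphM/= mulVf ?gt_eqF// scale1r.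
have Fb (e : R) : 0 < e -> exists z : disk_space T, \forall y \near F, `|z - y| < e%:C.
  move=> e0; have /cauchyP/(_ e%:C) := Fc.
  rewrite ltcR => /(_ e0)[z Fz]; exists z; apply: filterS Fz => y.
  by rewrite -ball_normE.
have cF : cauchy ((fun y : disk_space T => val y) @ F).
  move=> E /entourage_nbhs0[U U0 UE].
  have [D [D0 aD DU DDU]] := nbhs_absconvex_half U0.
  have [r r0 Tr] := bT D D0 aD.
  have [|z Fz] := Fb r^-1; first by rewrite invr_gt0.
  have zD y : `|z - y| < r^-1%:C -> D (val z - val y).
    move=> /disk_norm_lt; rewrite disk_valB => -[_ /Tr[u Du <-] <-].
    by rewrite scalerA -rmorphM/= mulVf ?gt_eqF// scale1r.
  exists ((fun y : disk_space T => val y) @` [set y | `|z - y| < r^-1%:C],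
          (fun y : disk_space T => val y) @` [set y | `|z - y| < r^-1%:C]) => /=.
    by split; apply: filterS Fz => y yz; exists y.
  move=> [_ _] [/= [y yz <-] [w wz <-]]; apply: UE.
  have -> : val y - val w = - (val z - val y) + (val z - val w).
    by rewrite opprB addrA subrK.
  by apply: DDU; [apply: absconvexN => //; exact: zD|exact: zD].
have [l Fl] := @frechet_complete _ V _ _ cF.
have key (e : R) z : 0 < e -> (\forall y \near F, `|z - y| < e%:C) -> dilate e (disk_set T) (l - val z).
  move=> e0 Fz; rewrite -[e]mul1r; apply: closed_disk_approx => // U U0 aU.
  rewrite dilate1.
  have /cvg_diskP/(_ U U0 aU) := Fl; rewrite near_map => FU.
  have [y [yU yz]] := filter_ex (filterI FU Fz).
  exists (val y - val z).
    rewrite -opprB -disk_valB; apply: (absconvexN (absconvex_dilate e aT)).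
    exact: disk_norm_lt.
  by exists (l - val y); [rewrite -opprB; exact: absconvexN|rewrite addrC addrA subrK].
have [z1 Fz1] := Fb 1 ltr01.
have lspan : l \in disk_span T.
  have := rpredD (dilate_span (key 1 z1 ltr01 Fz1)) (valP z1).
  by rewrite subrK.
apply/cvg_ex; exists (DiskSpace lspan).
apply/cvgrPdist_lt => e /gtc0_real[r r0 ->].
have r2 : 0 < r / 2 by rewrite divr_gt0.
have [z Fz] := Fb _ r2; apply: filterS (Fz) => y yz.
rewrite -[DiskSpace lspan](subrK z) -addrA.
apply: le_lt_trans (ler_normD _ _) _; rewrite [r]splitr rmorphD.
apply: ler_ltD yz; apply: disk_norm_le; first exact: ltW.
by rewrite disk_valB; exact: key.
Qed.

(* Metrizability: a suitable null sequence of scalars makes the union of the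
   rescaled sets bounded. *)
Lemma countably_absorbing_disk (S : nat -> set V) : (forall m, B (S m)) ->
  exists T : disk V, [/\ closed (disk_set T), B (disk_set T) &
    forall m, exists2 M : R, 0 < M & S m `<=` dilate M (disk_set T)].
Proof.
move=> BS; have [U UP [Umono Ubasis]] := frechet_basis.
have /choice[r rP] : forall m, exists r : R, 0 < r /\ S m `<=` dilate r (U m).
  move=> m; have [Um aUm] := UP m.
  have /von_neumannP/(_ _ Um aUm)[r r0 Sr] := adm_von_neumann admB (BS m).
  by exists r.
pose S' m := dilate (r m)^-1 (S m).
have r0 m : 0 < r m by case: (rP m).
have BS' m : B (S' m) by apply: (adm_dilate admB) => //; rewrite invr_gt0.
have S'U m : S' m `<=` U m.
  move=> _ [x /(rP m).2 [u Uu <-] <-].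
  by rewrite scalerA -rmorphM/= mulVf ?gt_eqF// scale1r.
pose W := \bigcup_m S' m.
have BW : B W.
  (* From index [N] on the rescaled sets lie in [U N], hence in [D]; finitely many remain. *)
  apply: (adm_approx admB) => D D0 aD; have [N UN] := Ubasis D D0.
  exists ([set 0] `|` \bigcup_(m < N) S' m).
    elim: N {UN} => [|N IH].
      apply: (adm_subset admB _ (adm_set1 admB 0)).
      by move=> x [->//|[m]].
    apply: (adm_subset admB _ (adm_setU admB IH (BS' N))).
    move=> x [->|[m /=]]; first by left; left.
    rewrite ltnS leq_eqVlt => /orP[/eqP-> S'x|mN S'x]; first by right.
    by left; right; exists m.
  move=> x [m _ S'x]; have [mN|Nm] := ltnP m N.
    exists x; first by right; exists m.
    by exists 0; rewrite ?addr0//; case: aD.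
  exists 0; first by left.
  by exists x; rewrite ?add0r//; apply/UN/(Umono _ _ Nm)/S'U.
have aT := absconvex_disk_hull W.
have BT := adm_hull admB BW.
case: (aT) => T0 Tc Tv.
exists (@Disk _ _ (disk_hull W) T0 Tc Tv (fun x => bounded_disk_sep (adm_von_neumann admB BT))).
split=> //=; first exact: closed_disk_hull.
move=> m; exists (r m) => // x Sx; exists ((r m)^-1%:C *: x).
  by apply: subset_disk_hull; exists m => //; exists x.
by rewrite scalerA -rmorphM/= divff ?gt_eqF// scale1r.
Qed.

End FrechetSpaces.

(** * Differential operators *)

Section PartialsLinear.
Context {R : realType} {W : tvsType R[i]} {n : nat} (hW : hausdorff_space W).
Notation rc := (real_complex R).

Lemma is_partialZl i (a : R[i]) (f : 'rV[R]_n -> W) x l : is_partial rc i f x l ->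
  is_partial rc i (fun y => a *: f y) x (a *: l).
Proof.
move=> fl; rewrite /is_partial (_ : diff_quot _ _ _ _ = fun h => a *: diff_quot rc i f x h).
  exact: tvs_cvgZl.
by apply/funext => h; rewrite /diff_quot -scalerBr !scalerA mulrC.
Qed.

Lemma partials_linearP s (O : set 'rV[R]_n) (a : R[i]) (f g : 'rV[R]_n -> W) x : open O ->
  smooth_on rc O f -> smooth_on rc O g -> O x ->
  partials rc s (fun y => a *: f y + g y) x = a *: partials rc s f x + partials rc s g x.
Proof.
move=> oO sf sg; elim: s x => [//|i s IH] x Ox /=.
have -> : partial rc i (partials rc s (fun y => a *: f y + g y)) x =
    partial rc i (fun y => a *: partials rc s f y + partials rc s g y) x.
  by apply: partial_near; apply: filterS (open_nbhs_nbhs (conj oO Ox)) => y /IH.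
apply: partialE => //; apply: is_partialD.
  apply: is_partialZl; exact: smooth_on_is_partial (smooth_on_partials s sf) Ox.
exact: smooth_on_is_partial (smooth_on_partials s sg) Ox.
Qed.

Lemma partials0 s (x : 'rV[R]_n) : partials rc s (fun=> 0 : W) x = 0.
Proof.
elim: s x => [//|i s IH] x /=.
rewrite (_ : partials rc s (fun=> 0) = fun=> 0); last by apply/funext.
exact: partialE (is_partial_cst _ _ _ _).
Qed.

Lemma partials_near0 s (f : 'rV[R]_n -> W) (x : 'rV[R]_n) : (\forall y \near x, f y = 0) ->
  \forall y \near x, partials rc s f y = 0.
Proof.
move=> f0; have := @partials_near _ _ rc _ _ s f (fun=> 0) x f0.
by apply: filterS => y fy; rewrite fy partials0.
Qed.

End PartialsLinear.

(** There are finitely many such words; induction strips the first letter, which ranges over a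
    finite type. *)
Lemma filter_words (T : Type) (I : finType) (F : set_system T) (FF : Filter F) m
    (Q : seq I -> T -> Prop) : (forall s, \forall z \near F, Q s z) ->
  \forall z \near F, forall s, (size s <= m)%N -> Q s z.
Proof.
elim: m Q => [|m IH] Q h.
  by apply: filterS (h [::]) => z Qz [].
have := IH (fun s z => forall i, Q (i :: s) z) (fun s => filter_forall FF (fun i => h (i :: s))).
by apply: filterS2 (h [::]) => z Q0 Qm [|i s] // sm; exact: Qm.
Qed.

Section DifferentialOperators.
Context {R : realType} {n : nat} (G : lieGroupType R n) (W : tvsType R[i]).
Hypothesis hW : hausdorff_space W.
Notation rc := (real_complex R).

(** Derivatives in a chart have no global meaning; weighted by a function supported in the chart
    they form a differential operator on [G], to which topological smoothness applies. *)
Lemma partials_cutoff_operator (c : chart R n G) (h : G -> R[i]^o) (K : set G) s : atlas c ->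
  smooth h -> compact K -> K `<=` chart_dom c -> (forall x, ~ K x -> h x = 0) ->
  diff_operator (fun (f : G -> W) x =>
    (h x : R[i]) *: partials rc s (f \o chart_inv c) (chart_fun c x)).
Proof.
move=> ac sh cK Kc hK; exists (size s) => x0.
have [cx0|cx0] := pselect (chart_dom c x0).
  exists c, (chart_img c), (fun t => if t == s then h \o chart_inv c else fun=> 0).
  split; first by split=> //; [exact: chart_img_open|exact: chart_img_fun].
  split.
    move=> t; case: ifP => _; first exact: sh.
    apply: (@smooth_on_subset _ _ _ _ _ setT) => //.
    by apply/smooth_on_Ck => k; apply: Ck_cst; [exact: norm_hausdorff|exact: openT].
  move=> f sf y cy; have [_ cyK] := chart_imgK cy.
  rewrite (bigD1 (Ordinal (ltnSn (size s))))//= (bigD1 (in_tuple s))//= eqxx cyK.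
  rewrite big1 ?addr0 => [|t ts]; last by rewrite -val_eqE/= in ts; rewrite (negbTE ts) scale0r.
  rewrite big1 ?addr0// => m ms; rewrite big1// => t _.
  case: eqP => [ts|_]; last by rewrite scale0r.
  have sm : size s = m by rewrite -(size_tuple t) ts.
  by case/eqP: ms; apply: val_inj.
have Kx0 : ~ K x0 by move=> /Kc.
have [d ad dx0] := atlas_cover x0.
have Kcl : closed K by apply: compact_closed => //; exact: lie_hausdorff.
(* Around a point outside the domain of [c], another chart restricted to the complement of [K] has
   all coefficients zero. *)
exists d, (chart_img d `&` chart_inv d @^-1` ~` K), (fun _ _ => 0); split.
  split=> //; first by apply: open_chart_preimage; exact: closed_openC.
  by split; [exact: chart_img_fun|rewrite /= chart_funK].
split.
  move=> t; apply: (@smooth_on_subset _ _ _ _ _ setT) => //.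
  by apply/smooth_on_Ck => k; apply: Ck_cst; [exact: norm_hausdorff|exact: openT].
move=> f sf y [_ Ky]; rewrite hK// scale0r big1// => m _; rewrite big1// => t _.
by rewrite scale0r.
Qed.

Lemma diff_operator_linear (P : (G -> W) -> (G -> W)) a f g x : diff_operator P ->
  smooth f -> smooth g -> smooth (fun x => a *: f x + g x) ->
  P (fun x => a *: f x + g x) x = a *: P f x + P g x.
Proof.
move=> [k /(_ x)[c [U [b [[ac cx _ Ox _] [_ PE]]]]]] sf sg sfg.
have := PE _ sfg _ Ox; have := PE _ sf _ Ox; have := PE _ sg _ Ox.
rewrite chart_funK// => -> -> ->; rewrite scaler_sumr -big_split/=.
apply: eq_bigr => m _; rewrite scaler_sumr -big_split/=; apply: eq_bigr => s _.
rewrite [partials _ _ _ _](_ : _ = partials rc s (fun y => a *: (f \o chart_inv c) y + (g \o chart_inv c) y) (chart_fun c x))//.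
have oc : open (chart_img c) by exact: chart_img_open.
rewrite (partials_linearP hW s a oc (sf c ac) (sg c ac)); last exact: chart_img_fun.
by rewrite scalerDr !scalerA mulrC.
Qed.

Lemma diff_operator_near (P : (G -> W) -> (G -> W)) f g x : diff_operator P ->
  smooth f -> smooth g -> (\forall y \near x, f y = g y) -> P f x = P g x.
Proof.
move=> [k /(_ x)[c [U [b [[ac cx _ Ox _] [_ PE]]]]]] sf sg fg.
have := PE _ sf _ Ox; have := PE _ sg _ Ox; rewrite chart_funK// => -> ->.
apply: eq_bigr => m _; apply: eq_bigr => s _; congr (_ *: _).
have : \forall y \near chart_fun c x, (f \o chart_inv c) y = (g \o chart_inv c) y.
  apply: (@near_chart_inv _ _ _ c (chart_fun c x) [set y | f y = g y]).
    exact: chart_img_fun.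
  by rewrite chart_funK.
by move=> h; exact: (nbhs_singleton (@partials_near _ _ rc _ _ s _ _ _ h)).
Qed.

End DifferentialOperators.

(** * Equicontinuity of differential operators along orbit maps *)

Section TopologicalSmoothness.
Context {R : realType} {n : nat} {G : lieGroupType R n} {V : frechetType R[i]}.
Variable pi : representation G V.
Notation rc := (real_complex R).
Let hV : hausdorff_space V := @frechet_hausdorff _ V.

Lemma orbit_mapP (a : R[i]) u v x : orbit_map pi (a *: u + v) x = a *: orbit_map pi u x + orbit_map pi v x.
Proof. by rewrite /orbit_map linearP. Qed.

Lemma orbit_map0 x : orbit_map pi 0 x = 0.
Proof. by rewrite /orbit_map linear0. Qed.

Hypothesis ts : topologically_smooth pi.

Lemma topologically_smooth_orbit v : smooth (orbit_map pi v).
Proof. by case: ts => F _ <-; have := set_valP (F v). Qed.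

Lemma topologically_smooth_cvg (P : (G -> V) -> (G -> V)) (L : set G) U :
  diff_operator P -> compact L -> nbhs (0 : V) U ->
  \forall w \near (0 : V), forall x, L x -> U (P (orbit_map pi w) x).
Proof.
move=> dP cL U0; have [F Fc FE] := ts.
pose P' : @diff_operators R n G V := SigSub (mem_set dP).
have [E eE EU] := nbhs0_entourage U0.
pose D w : {family compact, G -> V} := derivatives (F w : @smooth_maps R n G V) P'.
have DE w : D w = P (orbit_map pi w) by rewrite /D /derivatives/= -FE.
have P0 x : P (orbit_map pi 0) x = 0.
  have s0 := topologically_smooth_orbit 0.
  have E0 : (fun x => (-1 : R[i]) *: orbit_map pi 0 x + orbit_map pi 0 x) = orbit_map pi 0.
    by apply/funext => y; rewrite !orbit_map0 scaler0 addr0.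
  have := @diff_operator_linear _ _ _ _ hV P (-1) (orbit_map pi 0) (orbit_map pi 0) x dP s0 s0.
  by rewrite E0 scaleN1r addNr; apply.
have cD : {for (0 : V), continuous D}.
  apply: (continuous_comp (f := fun w => derivatives (F w : @smooth_maps R n G V))
    (g := @proj _ (fun=> {family compact, G -> V}) P')).
    exact: (continuous_comp (Fc 0) (@initial_continuous _ _ _ _)).
  exact: proj_continuous.
have := cD _ (fam_nbhs _ (entourage_inv eE) cL).
rewrite nbhs_filterE/=; apply: filterS => w h x Lx.
by have := EU _ _ (h x Lx); rewrite !DE P0 subr0.
Qed.

End TopologicalSmoothness.

(** * From topological to bornological smoothness *)

Lemma continuous_locally_bounded (R : realType) n (a : 'rV[R]_n -> R[i]^o) y :
  {for y, continuous a} -> exists2 C : R, 0 <= C & \forall z \near y, `|a z : R[i]| <= C%:C.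
Proof.
move=> ca; have [C C0 aC] := norm_real (a y : R[i]).
exists (C + 1); first by rewrite addr_ge0.
have /(@cvgrPdist_le _ _ _ (nbhs y) (nbhs_filter y))/(_ 1 ltr01) := ca.
apply: filterS => z az; rewrite [leRHS](_ : _ = `|a y : R[i]| + 1); last by rewrite aC -rmorphD.
rewrite -[a z](subKr (a y)).
by apply: le_trans (ler_normB _ _) _; rewrite lerD2l.
Qed.

Section TopologicalToBornological.
Context {R : realType} {n : nat} {G : lieGroupType R n} {V : frechetType R[i]}.
Variable pi : representation G V.
Notation rc := (real_complex R).
Let hV : hausdorff_space V := @frechet_hausdorff _ V.
Hypothesis ts : topologically_smooth pi.
Variable B : set_system V.
Hypothesis admB : admissible B.
Variables (S : set V) (BS : B S).

Let so v : smooth (orbit_map pi v) := topologically_smooth_orbit ts v.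

(** The operator [Q], which is the derivative weighted by a bump [h], acts equicontinuously over the
    compact [K], so [adm_image] bounds its values on [S]. Near [x0], where [h = 1], these are the
    derivatives themselves. *)
Lemma partials_orbit_bounded (c : chart R n G) x0 s : atlas c -> chart_dom c x0 ->
  exists2 A, B A & \forall x \near x0, forall v, S v ->
    A (partials rc s (orbit_map pi v \o chart_inv c) (chart_fun c x)).
Proof.
move=> ac cx0; have [h [K [sh cK Kc hK h1]]] := exists_bump ac cx0.
pose Q (f : G -> V) x := (h x : R[i]) *: partials rc s (f \o chart_inv c) (chart_fun c x).
have dQ : diff_operator Q by exact: (partials_cutoff_operator V s ac sh cK Kc hK).
exists [set Q (orbit_map pi v) x | v in S & x in K]; last first.
  apply: filterS h1 => x hx v Sv; exists v => //; exists x.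
    apply: contrapT => /hK hx0; move: hx; rewrite hx0 => /esym/eqP.
    by rewrite oner_eq0.
  by rewrite /Q hx scale1r.
apply: (adm_image admB (F := fun v => Q (orbit_map pi v))) => //.
- move=> x a u v; have [Kx|Kx] := pselect (K x); last by rewrite /Q hK// !scale0r scaler0 addr0.
  have -> : orbit_map pi (a *: u + v) = fun x => a *: orbit_map pi u x + orbit_map pi v x.
    by apply/funext => y; exact: orbit_mapP.
  apply: (diff_operator_linear hV) => //.
  have -> : (fun x => a *: orbit_map pi u x + orbit_map pi v x) = orbit_map pi (a *: u + v).
    by apply/funext => y; rewrite orbit_mapP.
  exact: so.
- move=> v; apply: continuous_in_subspaceT => x; rewrite inE => /Kc cx.
  have cimg := chart_img_fun cx.
  apply: (tvs_continuousZ (a := h) (f := fun x => partials rc s (orbit_map pi v \o chart_inv c) (chart_fun c x))).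
    apply: (@near_cvg _ _ (nbhs x) _ ((h \o chart_inv c) \o chart_fun c)).
      by apply: filterS (near_chart_dom cx) => z cz; rewrite /= chart_funK.
    rewrite -[in X in _ --> X](chart_funK cx).
    apply: continuous_comp; first exact: chart_fun_continuous.
    exact: (smooth_on_continuous (sh c ac)).
  apply: continuous_comp; first exact: chart_fun_continuous.
  exact: (smooth_on_continuous (smooth_on_partials s (so v ac))).
- by move=> U U0; exact: topologically_smooth_cvg.
Qed.

(** One bounded set serves all points of [K] and all words up to length [m]; the chart may still
    vary with the point. *)
Lemma partials_orbit_bounded_order m (K : set G) : compact K ->
  exists2 A, B A & forall x, K x -> exists c : chart R n G,
    [/\ atlas c, chart_dom c x & \forall z \near x, forall s, (size s <= m)%N -> forall v, S v ->
      A (partials rc s (orbit_map pi v \o chart_inv c) (chart_fun c z))].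
Proof.
move=> /compact_near_coveringP cK.
have FB : Filter (eventually_in B) := eventually_in_filter (adm_set1 admB 0) (adm_setU admB).
have := cK _ (eventually_in B) (fun A x => exists c : chart R n G,
    [/\ atlas c, chart_dom c x & \forall z \near x, forall s, (size s <= m)%N -> forall v, S v ->
      A (partials rc s (orbit_map pi v \o chart_inv c) (chart_fun c z))]) FB.
case=> [x Kx|A BA h]; last by exists A => // x Kx; exact: h.
have [c ac cx] := atlas_cover x.
have : \forall z \near x & A \near eventually_in B, forall s, (size s <= m)%N -> forall v, S v ->
      A (partials rc s (orbit_map pi v \o chart_inv c) (chart_fun c z)).
  apply: (@filter_words _ _ (filter_prod (nbhs x) (eventually_in B)) _ m (fun s zA => forall v, S v ->
      zA.2 (partials rc s (orbit_map pi v \o chart_inv c) (chart_fun c zA.1)))) => s.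
  have [A BA xA] := partials_orbit_bounded s ac cx.
  exists ([set z | forall v, S v ->
    A (partials rc s (orbit_map pi v \o chart_inv c) (chart_fun c z))], [set A' | A `<=` A']) => /=.
    by split=> //; exists A.
  by move=> [z A'] [/= hz AA'] v Sv; apply/AA'/hz.
move=> [[X Y]/= [xX BY] XY].
exists ([set z | chart_dom c z /\ nbhs z X], Y) => /=.
  by split=> //; apply: filterI; [exact: near_chart_dom|exact: nbhs_interior].
move=> [z A] [/= [cz zX] YA]; exists c; split=> //.
by apply: filterS zX => w Xw; exact: (XY (w, A)).
Qed.

Variables (h : G -> R[i]^o) (sh : smooth h) (K : set G) (cK : compact K).
Hypothesis hK : forall x, ~ K x -> h x = 0.

Let clK : closed K. Proof. by apply: compact_closed => //; exact: lie_hausdorff. Qed.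

Lemma cutoff_orbit_outside v (d : chart R n G) y : chart_img d y -> ~ K (chart_inv d y) ->
  \forall z \near y, cutoff h (orbit_map pi v) (chart_inv d z) = 0.
Proof.
move=> dy Ky; have : \forall x \near chart_inv d y, ~ K x.
  by apply: open_nbhs_nbhs; split=> //; exact: closed_openC.
by move=> /(near_chart_inv dy); apply: filterS => z /hK h0; rewrite /cutoff h0 scale0r.
Qed.

Lemma near_outside (d : chart R n G) y : chart_img d y -> ~ K (chart_inv d y) ->
  \forall z \near y, chart_img d z /\ ~ K (chart_inv d z).
Proof.
move=> dy Ky; apply: filterI; first exact: near_chart_img.
apply: (near_chart_inv (A := ~` K) dy).
by apply: open_nbhs_nbhs; split=> //; exact: closed_openC.
Qed.

Lemma cutoff_orbit_smooth v : smooth (cutoff h (orbit_map pi v)).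
Proof.
by move=> d ad; apply: (smooth_onZ hV); [exact: chart_img_open|exact: sh|exact: so].
Qed.

(** The bounded sets [A m] concern one selected chart around each point of [K]. In another chart [d]
    a derivative is a combination of derivatives of at most the same order in the selected one, with
    coefficients that are locally bounded and independent of [v]. Off [K] everything vanishes
    nearby. *)
Lemma exists_disk_for_cutoff : exists T : disk V, [/\ closed (disk_set T), B (disk_set T) &
  forall (d : chart R n G) y s, atlas d -> chart_img d y -> exists2 M : R, 0 < M &
    \forall z \near y, forall v, S v ->
      dilate M (disk_set T) (partials rc s (cutoff h (orbit_map pi v) \o chart_inv d) z)].
Proof.
have /choice[A AP] : forall m, exists A, B A /\ forall x, K x -> exists c : chart R n G,
    [/\ atlas c, chart_dom c x & \forall z \near x, forall s, (size s <= m)%N -> forall v, S v ->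
      A (partials rc s (orbit_map pi v \o chart_inv c) (chart_fun c z))].
  by move=> m; have [A BA h'] := partials_orbit_bounded_order m cK; exists A.
have [T [clT BT TA]] := countably_absorbing_disk admB (fun m => (AP m).1).
exists T; split=> // d y s ad dy; have aT := absconvex_disk T.
have [Ky|Ky] := pselect (K (chart_inv d y)); last first.
  exists 1 => //; apply: filterS (near_outside dy Ky) => z [dz Kz] v _.
  have /nbhs_singleton -> := partials_near0 hV s (cutoff_orbit_outside v dz Kz).
  by exists 0; rewrite ?scaler0//; exact: disk0.
have [c [ac cy hc]] := (AP (size s)).2 _ Ky.
have [M M0 AM] := TA (size s).
have aD := absconvex_dilate M aT.
have Oy : overlap c d y by [].
have oO : open (overlap c d) by exact: open_overlap.
have shd : smooth_on rc (overlap c d) (h \o chart_inv d).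
  by apply: smooth_on_subset (sh ad) => z [].
have oc : open (chart_img c) by exact: chart_img_open.
have [I [a [t [aP aE]]]] := partials_weighted_comp hV oO oc (@transition_img _ _ _ c d)
  (transition_smooth ac ad) shd s.
have /choice[C CP] : forall u : I, exists C : R, 0 <= C /\ \forall z \near y, `|a u z| <= C%:C.
  move=> u; have [C C0 aC] := continuous_locally_bounded (smooth_on_continuous (aP u).1 Oy).
  by exists C.
have C0 : 0 <= \sum_u C u by apply: sumr_ge0 => u _; case: (CP u).
(* [C u] bounds the coefficients near [y] and [M] absorbs the derivatives in [c]; the summand 1
   ensures positivity. *)
exists ((1 + \sum_u C u) * M); first by rewrite mulr_gt0// ltr_wpDr.
have h1 : \forall z \near y, forall u, `|a u z| <= (C u)%:C.
  by apply: (@filter_forall _ _ _ (nbhs y)) => u; case: (CP u).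
have h2 := near_chart_inv dy hc.
apply: filterS3 h1 h2 (open_nbhs_nbhs (conj oO Oy)) => z az cz Oz v Sv.
have -> : partials rc s (cutoff h (orbit_map pi v) \o chart_inv d) z =
    \sum_u (a u z : R[i]) *: partials rc (t u) (orbit_map pi v \o chart_inv c) (transition c d z).
  rewrite -(aE _ (so v ac) z Oz).
  have : \forall w \near z, (cutoff h (orbit_map pi v) \o chart_inv d) w =
      ((h \o chart_inv d) w : R[i]) *: (orbit_map pi v \o chart_inv c) (transition c d w).
    apply: filterS (open_nbhs_nbhs (conj oO Oz)) => w [_ cw].
    by rewrite /cutoff /transition /= chart_funK.
  by move=> E; exact: (nbhs_singleton (@partials_near _ _ rc _ _ s _ _ _ E)).
have hT u : dilate M (disk_set T) (partials rc (t u) (orbit_map pi v \o chart_inv c) (transition c d z)).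
  by apply/AM/cz => //; case: (aP u).
have := dilate_sum (index_enum I) aD az (fun u => (CP u).1) hT.
move=> [_ [w Tw <-] <-]; rewrite scalerA -rmorphM.
apply: dilate_le aT _ _ _ _; last by exists w.
  by rewrite mulr_ge0// ltW.
by rewrite ler_pM2r// lerDr.
Qed.


Section Lifting.
Variables (T : disk V) (clT : closed (disk_set T)).
Hypothesis Tb : forall (d : chart R n G) y s, atlas d -> chart_img d y -> exists2 M : R, 0 < M &
    \forall z \near y, forall v, S v ->
      dilate M (disk_set T) (partials rc s (cutoff h (orbit_map pi v) \o chart_inv d) z).

Definition cutoff_lift v : G -> disk_space T := fun x => insubd 0 (cutoff h (orbit_map pi v) x).

Lemma cutoff_locally_disk_bounded v (d : chart R n G) : S v -> atlas d ->
  locally_disk_bounded T (chart_img d) (cutoff h (orbit_map pi v) \o chart_inv d).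
Proof.
move=> Sv ad s y dy; have [M M0 hM] := Tb s ad dy; exists M => //.
by apply: filterS hM => z; exact.
Qed.

Lemma cutoff_liftK v x : S v -> val (cutoff_lift v x) = cutoff h (orbit_map pi v) x.
Proof.
move=> Sv; have [d ad dx] := atlas_cover x; rewrite val_insubd.
have := locally_disk_bounded_span (cutoff_locally_disk_bounded Sv ad) (chart_img_fun dx).
by rewrite /= chart_funK// => ->.
Qed.

Lemma cutoff_lift_smooth v : S v -> smooth (cutoff_lift v).
Proof.
move=> Sv d ad; apply: (smooth_on_disk_lift hV clT (chart_img_open (c := d))).
  exact: cutoff_orbit_smooth.
exact: cutoff_locally_disk_bounded.
Qed.

Lemma cutoff_lift_outside v x : ~ K x -> cutoff_lift v x = 0.
Proof.
move=> /hK h0; apply: val_inj; rewrite val_insubd /cutoff h0 scale0r.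
by case: ifP.
Qed.

Lemma cutoff_lift_partials (d : chart R n G) y s : atlas d -> chart_img d y -> exists2 M : R, 0 <= M &
  \forall z \near y, forall v, S v -> `|partials rc s (cutoff_lift v \o chart_inv d) z| <= M%:C.
Proof.
move=> ad dy; have [M M0 hM] := Tb s ad dy; exists M; first exact: ltW.
apply: filterS2 hM (near_chart_img dy) => z Mz dz v Sv; have Mzv := Mz v Sv.
apply: disk_norm_le; first exact: ltW.
have -> : partials rc s (cutoff_lift v \o chart_inv d) z =
    disk_lift T (partials rc s (cutoff h (orbit_map pi v) \o chart_inv d)) z.
  apply: (partials_disk_lift hV clT (chart_img_open (c := d)) s) => //.
    exact: cutoff_orbit_smooth.
  exact: cutoff_locally_disk_bounded.
by rewrite disk_liftK//; exact: dilate_span Mzv.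
Qed.

(** Local bounds come from the chart formula for [P] and become one bound on [K] by compactness; off
    [K] the lifts vanish near the point, and so does the value of [P]. *)
Lemma cutoff_lift_operator P : diff_operator P ->
  exists M : R, forall v x, S v -> `|P (cutoff_lift v) x| <= M%:C.
Proof.
move=> [k dP]; have hT : hausdorff_space (disk_space T) by exact: norm_hausdorff.
have local (x : G) : exists C : R, \forall z \near x, forall v, S v -> `|P (cutoff_lift v) z| <= C%:C.
  have [d [U [a [[ad dx oU Ux Ud] [sa PE]]]]] := dP x.
  have dy := chart_img_fun dx.
  have /choice[C CP] : forall s, exists C : R, \forall z \near chart_fun d x, forall v, S v ->
      `|(a s z : R[i]) *: partials rc s (cutoff_lift v \o chart_inv d) z| <= C%:C.
    move=> s; have [C C0 hC] := continuous_locally_bounded (smooth_on_continuous (sa s) Ux).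
    have [M M0 hM] := cutoff_lift_partials s ad dy.
    exists (C * M); apply: filterS2 hC hM => z Cz Mz v Sv.
    by rewrite normrZ rmorphM; apply: ler_pM => //; exact: Mz.
  exists (\sum_(m < k.+1) \sum_(s : m.-tuple 'I_n) C s).
  have hw : nbhs (chart_fun d x) _ := @filter_words _ _ (nbhs (chart_fun d x)) (nbhs_filter _) k _ CP.
  have hx := near_chart_fun dx (@filterI _ (nbhs (chart_fun d x)) (nbhs_filter _) _ _ hw
    (open_nbhs_nbhs (conj oU Ux))).
  apply: filterS2 hx (near_chart_dom dx) => z [wz Uz] dz v Sv.
  rewrite -[z in P _ z](chart_funK dz) (PE _ (cutoff_lift_smooth Sv))//.
  rewrite rmorph_sum; apply: le_trans (ler_norm_sum _ _ _) _; apply: ler_sum => m _.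
  rewrite rmorph_sum; apply: le_trans (ler_norm_sum _ _ _) _; apply: ler_sum => s _.
  by apply: wz => //; rewrite size_tuple -ltnS.
have /compact_near_coveringP ncK := cK.
(* Letting the bound tend to infinity makes the near-covering property select a common one. *)
have := ncK _ (pinfty_nbhs R) (fun M x => forall v, S v -> `|P (cutoff_lift v) x| <= M%:C) _.
case.
  move=> x Kx; have [C hC] := local x; exists ([set z | forall v, S v -> `|P (cutoff_lift v) z| <= C%:C],
    [set M | C <= M]) => /=; first by split=> /=; [exact: hC|apply: nbhs_pinfty_ge; exact: num_real].
  move=> [z M] [/= hz CM] v Sv; apply: le_trans (hz v Sv) _; by rewrite lecR.
(* The bounds strictly above [M] are the valid ones, hence [M + 1]; the maximum with 0 covers points
   off [K]. *)
move=> M [Mr hM]; exists (Num.max 0 (M + 1)) => v x Sv.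
have [Kx|Kx] := pselect (K x).
  by apply: hM => //; rewrite lt_max ltrDl ltr01 orbT.
have [d [U [a [[ad dx oU Ux Ud] [sa PE]]]]] := dP x.
have dy := chart_img_fun dx.
rewrite -[x in P _ x](chart_funK dx) (PE _ (cutoff_lift_smooth Sv))//.
rewrite big1 ?normr0 ?lecR ?le_max ?lexx// => m _; rewrite big1// => s _.
have : \forall z \near chart_fun d x, (cutoff_lift v \o chart_inv d) z = 0.
  have Kdx : ~ K (chart_inv d (chart_fun d x)) by rewrite chart_funK.
  by apply: filterS (near_outside dy Kdx) => z [_ Kz]; exact: cutoff_lift_outside.
by move=> /(partials_near0 hT s)/nbhs_singleton ->; rewrite scaler0.
Qed.

Lemma cutoff_lift_bounded : bounded_test_functions (cutoff_lift @` S).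
Proof.
split.
- move=> _ [v Sv <-]; split; first exact: cutoff_lift_smooth.
  by exists K => // x; exact: cutoff_lift_outside.
- by exists K => // _ x [v Sv <-]; exact: cutoff_lift_outside.
- move=> P /cutoff_lift_operator[M hM]; exists M => _ x [v Sv <-]; exact: hM.
Qed.

End Lifting.

Lemma bounded_cutoff_orbit :
  bounded_born_test_functions B (cutoff h @` (orbit_map pi @` S)).
Proof.
have [T [clT BT Tb]] := exists_disk_for_cutoff; exists T.
  exact: closed_disk_complete.
exists (cutoff_lift T @` S); first exact: cutoff_lift_bounded.
have E v : S v -> disk_incl (cutoff_lift T v) = cutoff h (orbit_map pi v).
  by move=> Sv; apply/funext => x; exact: cutoff_liftK.
apply/seteqP; split=> [_ [_ [v Sv <-] <-]|_ [_ [v Sv <-] <-]].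
  by exists (cutoff_lift T v); [exists v|exact: E].
by rewrite E//; exists (orbit_map pi v) => //; exists v.
Qed.

End TopologicalToBornological.

Lemma topologically_smooth_bornologically (R : realType) (n : nat) (G : lieGroupType R n)
    (V : frechetType R[i]) (pi : representation G V) (B : set_system V) :
  admissible B -> topologically_smooth pi -> bornologically_smooth pi B.
Proof.
move=> admB ts.
have bnd S : B S -> forall h, test_functions G R[i]^o h ->
    bounded_born_test_functions B (cutoff h @` (orbit_map pi @` S)).
  by move=> BS h [sh [K cK hK]]; exact: bounded_cutoff_orbit hK.
have mem v : born_smooth_functions G B (orbit_map pi v).
  move=> h th; have [T bT [S' [S't _ _] E]] := bnd _ (adm_set1 admB v) h th.
  exists T => //; have : (cutoff h @` (orbit_map pi @` [set v])) (cutoff h (orbit_map pi v)).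
    by exists (orbit_map pi v) => //; exists v.
  by rewrite E => -[f S'f <-]; exists f => //; exact: S't.
split=> // S BS; split=> [_ [v _ <-]|h th]; first exact: mem.
exact: bnd.
Qed.

(** * From bornological to topological smoothness *)

Section DiskInclusion.
Context {R : realType} {V : tvsType R[i]} (hV : hausdorff_space V) (T : disk V).
Hypothesis vT : von_neumann (disk_set T).
Notation rc := (real_complex R).

Lemma disk_val_sum (I : Type) (r : seq I) (F : I -> disk_space T) :
  val (\sum_(i <- r) F i) = \sum_(i <- r) val (F i).
Proof. by apply: (big_morph (fun u : disk_space T => val u : V)). Qed.

Lemma disk_val_continuous : continuous (val : disk_space T -> V).
Proof.
move=> u; apply/(@cvg_diskP _ _ _ (nbhs u) (nbhs_filter u)) => D D0 aD.
have [r r0 TD] := (von_neumannP _).1 vT D D0 aD.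
have r10 : 0 < r^-1 by rewrite invr_gt0.
have e0 : 0 < (r^-1)%:C :> R[i] by rewrite ltcR.
have := nbhsx_ballx u _ e0; apply: filterS => w.
rewrite -ball_normE/= distrC => /disk_norm_lt[t /TD[d Dd <-] ].
by rewrite disk_valB => <-; rewrite scalerA -rmorphM mulVf ?gt_eqF// scale1r.
Qed.

Context {n : nat} {G : lieGroupType R n}.

Let hT : hausdorff_space (disk_space T). Proof. exact: norm_hausdorff. Qed.

Lemma disk_incl_smooth (f : G -> disk_space T) : smooth f -> smooth (disk_incl f).
Proof.
move=> sf c ac.
apply: (@smooth_on_linear _ _ _ rc rc _ _ _ hT hV (fun u : disk_space T => val u : V)) (sf c ac).
- exact: disk_valB.
- by [].
- exact: disk_val_continuous.
- exact: chart_img_open.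
Qed.

(** The local coefficients of [P] also act on functions into the span of [T], and the inclusion
    commutes with derivatives. Hence for smooth [f] the values of [P] lie in the span and the
    default 0 in [P'] is not taken. *)
Lemma diff_operator_disk (P : (G -> V) -> (G -> V)) : diff_operator P ->
  exists2 P', diff_operator P' &
    forall f : G -> disk_space T, smooth f -> forall x, P (disk_incl f) x = val (P' f x).
Proof.
move=> [k dP]; pose P' (f : G -> disk_space T) x : disk_space T := insubd 0 (P (disk_incl f) x).
have local (x0 : G) : exists (c : chart R n G) (U : set 'rV[R]_n) (a : seq 'I_n -> 'rV[R]_n -> R[i]^o),
  [/\ atlas c, chart_dom c x0, open U, U (chart_fun c x0) & U `<=` chart_img c] /\
  (forall s, smooth_on rc U (a s)) /\
  forall f : G -> disk_space T, smooth f -> forall y, U y ->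
    P (disk_incl f) (chart_inv c y) = val (\sum_(m < k.+1) \sum_(s : m.-tuple 'I_n)
      (a s y : R[i]) *: partials rc s (f \o chart_inv c) y).
  have [c [U [a [[ac cx oU Ux Uc] [sa PE]]]]] := dP x0; exists c, U, a; split=> //; split=> // f sf y Uy.
  rewrite (PE _ (disk_incl_smooth sf) _ Uy) disk_val_sum; apply: eq_bigr => m _.
  rewrite disk_val_sum; apply: eq_bigr => s _; rewrite disk_valZ; congr (_ *: _).
  apply: (@partials_linear _ _ _ rc rc _ _ _ hT hV (fun u : disk_space T => val u : V) _ _ _ s (chart_img c)).
  - exact: disk_valB.
  - by [].
  - exact: disk_val_continuous.
  - exact: chart_img_open.
  - exact: sf.
  - exact: Uc.
have P'E f : smooth f -> forall x, P (disk_incl f) x = val (P' f x).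
  move=> sf x; have [c [U [a [[ac cx oU Ux Uc] [sa PE]]]]] := local x.
  by have := PE f sf _ Ux; rewrite /P' chart_funK// => ->; rewrite valKd.
exists P' => //; exists k => x0; have [c [U [a [h [sa PE]]]]] := local x0.
exists c, U, a; split=> //; split=> // f sf y Uy.
by apply: val_inj; rewrite -P'E// PE.
Qed.

End DiskInclusion.

Section BornologicalToTopological.
Context {R : realType} {n : nat} {G : lieGroupType R n} {V : frechetType R[i]}.
Variable pi : representation G V.
Let hV : hausdorff_space V := @frechet_hausdorff _ V.
Variable B : set_system V.
Hypothesis admB : admissible B.
Hypothesis bs : bornologically_smooth pi B.

Lemma cutoff_orbit_bounded (h : G -> R[i]^o) S : test_functions G R[i]^o h -> B S ->
  exists2 T : disk V, von_neumann (disk_set T) &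
    (forall v, S v -> smooth (cutoff h (orbit_map pi v))) /\
    forall P, diff_operator P -> exists2 M : R, 0 < M &
      forall v x, S v -> dilate M (disk_set T) (P (cutoff h (orbit_map pi v)) x).
Proof.
move=> th BS; have [T [BT _ _] [S' [S't _ S'b] E]] := (bs.2 S BS).2 h th.
have vT := adm_von_neumann admB BT; exists T => //.
have lift v : S v -> exists2 f, S' f & disk_incl f = cutoff h (orbit_map pi v).
  move=> Sv; suff : (@disk_incl _ _ G _ T @` S') (cutoff h (orbit_map pi v)) by [].
  by rewrite -E; exists (orbit_map pi v) => //; exists v.
split=> [v /lift[f /S't[sf _] <-]|P dP]; first exact: disk_incl_smooth.
have [P' dP' PP'] := diff_operator_disk hV vT dP.
have [M PM] := S'b P' dP'.
(* A positive constant strictly above [M], since passing from the gauge to a multiple of [T] takes a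
   strict inequality. *)
exists (Num.max 0 M + 1); first by rewrite ltr_wpDl// le_max lexx.
move=> v x /lift[f S'f <-]; have [sf _] := S't f S'f; rewrite PP'//.
apply: disk_norm_lt; apply: le_lt_trans (PM f x S'f) _.
by rewrite ltcR ltr_pwDr// le_max lexx orbT.
Qed.

Lemma bornologically_smooth_orbit v : smooth (orbit_map pi v).
Proof.
move=> c ac s y cy; suff : smooth_on (real_complex R) [set y] (orbit_map pi v \o chart_inv c).
  exact.
have [cx _] := chart_imgK cy; have [h [K [sh cK _ hK h1]]] := exists_bump ac cx.
have [||T _ [sv _]] := @cutoff_orbit_bounded h [set v]; first by split=> //; exists K.
  exact: adm_set1.
apply: (@smooth_on_near _ _ _ _ _ _ (cutoff h (orbit_map pi v) \o chart_inv c)).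
  move=> _ ->; have := near_chart_inv cy h1; apply: filterS => z /= hz.
  by rewrite /cutoff hz scale1r.
by apply: smooth_on_subset (sv v erefl c ac) => _ ->.
Qed.

Let so := bornologically_smooth_orbit.

Lemma orbit_operatorP (P : (G -> V) -> (G -> V)) a u v x : diff_operator P ->
  P (orbit_map pi (a *: u + v)) x = a *: P (orbit_map pi u) x + P (orbit_map pi v) x.
Proof.
move=> dP; have E : orbit_map pi (a *: u + v) = fun x => a *: orbit_map pi u x + orbit_map pi v x.
  by apply/funext => y; exact: orbit_mapP.
by rewrite E; apply: (diff_operator_linear hV) => //; rewrite -E.
Qed.

Lemma orbit_operatorB (P : (G -> V) -> (G -> V)) u v x : diff_operator P ->
  P (orbit_map pi (u - v)) x = P (orbit_map pi u) x - P (orbit_map pi v) x.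
Proof. by move=> dP; rewrite addrC -scaleN1r orbit_operatorP// scaleN1r addrC. Qed.

Lemma orbit_operatorZ (P : (G -> V) -> (G -> V)) a v x : diff_operator P ->
  P (orbit_map pi (a *: v)) x = a *: P (orbit_map pi v) x.
Proof.
move=> dP; have := orbit_operatorP a v 0 x dP; rewrite addr0 => ->.
by rewrite -(subrr v) orbit_operatorB// subrr addr0.
Qed.

Lemma bornologically_smooth_near (P : (G -> V) -> (G -> V)) (x0 : G) U : diff_operator P ->
  nbhs (0 : V) U -> \forall x \near x0 & w \near (0 : V), U (P (orbit_map pi w) x).
Proof.
move=> dP U0; have [c ac cx0] := atlas_cover x0.
have [h [K [sh cK _ hK h1]]] := exists_bump ac cx0.
suff near0 : \forall w \near (0 : V), forall x, (\forall y \near x, h y = 1) -> U (P (orbit_map pi w) x).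
  exists ([set x | \forall y \near x, h y = 1],
    [set w | forall x, (\forall y \near x, h y = 1) -> U (P (orbit_map pi w) x)]) => /=.
    by split=> //; exact: nbhs_interior.
  by move=> [x w] [/= hx Uw]; exact: Uw.
apply: contrapT => nU; have [W W0 [Wd Wb]] := @frechet_basis R V.
(* Failure is exploited in the smaller neighbourhood [(k+1)^-1 W k]: then [s k] itself still tends
   to 0, so its range is bounded, and a factor tending to 0 is left over. *)
have /choice[s sP] : forall k : nat, exists s : V, W k s /\ exists x,
    (\forall y \near x, h y = 1) /\ ~ U (P (orbit_map pi ((k.+1%:R^-1 : R)%:C *: s)) x).
  move=> k; apply: contrapT => H; apply: nU.
  have : nbhs (0 : V) (dilate (k.+1%:R^-1) (W k)) by apply: nbhs_dilate; [rewrite invr_eq0|exact: (W0 k).1].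
  apply: filterS => _ [s Ws <-] x hx; apply: contrapT => nUx; apply: H.
  by exists s; split=> //; exists x.
have s0 : s @ \oo --> (0 : V).
  move=> A /Wb[m WA]; exists m => // k mk; apply: WA.
  by apply: (Wd _ _ mk); exact: (sP k).1.
have [||T vT [sc hT]] := @cutoff_orbit_bounded h (range s); first by split=> //; exists K.
  exact: adm_null.
have [M M0 PT] := hT P dP.
have [D [D0 aD DU]] := nbhs_absconvex U0.
have [r r0 TD] := (von_neumannP _).1 vT D D0 aD.
(* The values for [s k] lie in [M T], hence in [M r D]; this [k] brings those for [s k / (k+1)] into
   [D]. *)
have [k kP] : exists k : nat, r * M <= k.+1%:R.
  by exists (Num.bound (r * M)); rewrite ltW// (lt_trans (archi_boundP _))// ?ltr_nat// mulr_ge0// ltW.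
have [_ [x [hx]]] := sP k; apply; rewrite orbit_operatorZ//.
have Sk : range s (s k) by exists k.
have -> : P (orbit_map pi (s k)) x = P (cutoff h (orbit_map pi (s k))) x.
  apply: (diff_operator_near dP); [exact: so|exact: sc|].
  by apply: filterS hx => y hy; rewrite /cutoff hy scale1r.
have [t /TD[d Dd <-] <-] := PT (s k) x Sk.
apply: DU; rewrite !scalerA -!rmorphM -(dilate1 D).
apply: (@dilate_le _ _ D (k.+1%:R^-1 * M * r) 1) => //; last by exists d.
  by rewrite !mulr_ge0// ?invr_ge0// ltW.
by rewrite -mulrA ler_pdivrMl// mulr1 mulrC.
Qed.

Lemma bornologically_smooth_cvg (P : (G -> V) -> (G -> V)) (L : set G) U :
  diff_operator P -> compact L -> nbhs (0 : V) U ->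
  \forall w \near (0 : V), forall x, L x -> U (P (orbit_map pi w) x).
Proof.
move=> dP /compact_near_coveringP cL U0.
have := cL _ (nbhs (0 : V)) (fun w x => U (P (orbit_map pi w) x)) _; apply.
by move=> x _; exact: (@bornologically_smooth_near P x U dP U0).
Qed.

Lemma bornologically_smooth_topologically : topologically_smooth pi.
Proof.
pose F v : Cinfty G V := exist (fun f => f \in @smooth_maps R n G V) _ (mem_set (so v)).
exists F => //; apply: continuous_comp_initial => v.
apply/cvg_sup => -[P PD]; have dP : diff_operator P by exact: (set_mem PD).
move: v; apply: (@continuous_comp_initial (prod_topology (fun _ : @diff_operators R n G V =>
  {family compact, G -> V})) V {family compact, G -> V} (fun f => f (exist _ P PD))) => v.
apply/fam_cvgP => L cL A /uniform_nbhs[E [eE EA]].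
have [U U0 UE] := entourage_nbhs0 eE.
(* Linearity in the vector reduces continuity at [v] to the estimate at 0. *)
have vw : (fun w => v - w) @ v --> (0 : V).
  by rewrite -(subrr v); apply: tvs_cvgB; [exact: cvg_cst|exact: cvg_id].
have := vw _ (bornologically_smooth_cvg dP cL U0).
rewrite nbhs_filterE/=; apply: filterS => w hw; apply: EA => x Lx.
by apply: UE; have := hw x Lx; rewrite orbit_operatorB.
Qed.

End BornologicalToTopological.

Theorem theorem3p20 (R : realType) (n : nat) (G : lieGroupType R n)
    (V : frechetType R[i]) (pi : representation G V) :
  (topologically_smooth pi <-> bornologically_smooth pi von_neumann) /\
  (bornologically_smooth pi von_neumann <->
   bornologically_smooth pi precompact_bornology).
Proof.
have vN := @von_neumann_admissible R V; have pc := @precompact_admissible R V.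
have top_iff B : admissible B -> topologically_smooth pi <-> bornologically_smooth pi B.
  move=> admB; split; first exact: topologically_smooth_bornologically.
  exact: bornologically_smooth_topologically.
split; first exact: top_iff.
exact: iff_trans (iff_sym (top_iff _ vN)) (top_iff _ pc).
Qed.
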